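(* Let $(M,L)$ and $(M,\tilde L)$ be conformal Finsler manifolds with $\tilde g=e^{2\sigma(x)}g$. The curvature tensors $\tilde\Re$ and $\Re$ of the associated Barthel connections $\tilde\Gamma$ and $\Gamma$ are related, for all vector fields $X,Y$, by $$\tilde\Re(X,Y)=\Re(X,Y)-[\mathcal LX,\mathcal LY]-\mathcal L[hX,hY]+\mathfrak U_{X,Y}\{v[hX,\mathcal LY]+\mathcal L[hX,\mathcal LY]\},$$ where $\mathfrak U_{X,Y}\Theta(X,Y)=\Theta(X,Y)-\Theta(Y,X)$.
   Context: $M$ is a smooth manifold; $\mathcal TM\subset TM$ is the bundle of nonzero tangent vectors, and all identities are over $\mathcal TM$. $J$ is the natural almost tangent structure on $TM$ (locally $J\partial_i=\dot\partial_i$, $J\dot\partial_i=0$), $\mathcal C=y^i\dot\partial_i$ the Liouville field. A Finsler manifold $(M,L)$: $L:TM\to\mathbb R$, $L\ge0$, $L(0)=0$, $L$ is $C^\infty$ on $\mathcal TM$, $C^1$ on $TM$, $\mathcal C\cdot L=L$, and $g$ with components $g_{ij}=\frac12\dot\partial_i\dot\partial_jL^2$ is positive definite; $g$ is a metric in the pullback bundle $\pi^{-1}(TM)\to\mathcal TM$. Put $E=\frac12L^2$. For functions $f$: $d_Jf(X)=df(JX)$, $d_Gf=G\cdot f$. $\Omega:=dd_JE$ (nondegenerate); the canonical spray $G$ is defined by $i_G\Omega=-dE$. For a vector field $Z$, $[J,Z]X:=[JX,Z]-J[X,Z]$. The Barthel connection is $\Gamma=[J,G]$, with horizontal and vertical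 projectors $h=\frac12(I+\Gamma)$, $v=\frac12(I-\Gamma)$. The curvature of $\Gamma$ is the vector 2-form $\Re=-\frac12[h,h]$ (Frölicher–Nijenhuis bracket), i.e. $\Re(X,Y)=-v[hX,hY]$. The metric $\bar g$ on the vertical bundle is $\bar g(JY,JZ)=\Omega(JY,Z)$, and $\mathrm{grad}_v\sigma$ is the vertical vector field with $d\sigma(Y)=\bar g(\mathrm{grad}_v\sigma,JY)$ for all $Y$. $\sigma$ is a smooth function on $M$, identified with its pullback to $TM$. Objects with tilde are those of $(M,\tilde L)$. The vector 1-form $\mathcal L$ is $$\mathcal L:=d\sigma\otimes\mathcal C+\sigma_1J-d_JE\otimes\mathrm{grad}_v\sigma-E\,[J,\mathrm{grad}_v\sigma],\qquad \sigma_1:=d_G\sigma,$$ and it satisfies $\tilde\Gamma=\Gamma-2\mathcal L$. *)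

(* Defs.v *)
From mathcomp Require Import all_boot all_order all_algebra.
From mathcomp Require Import all_classical all_reals all_analysis.

Set Implicit Arguments.
Unset Strict Implicit.
Unset Printing Implicit Defensive.

Import Order.TTheory GRing.Theory Num.Theory.
Import numFieldNormedType.Exports.

Local Open Scope classical_set_scope.
Local Open Scope ring_scope.

(** [Ck k D f]: [f] is of class C^k on the open set [D].  A map is C^(k+1)
    iff it is Frechet differentiable and all its directional derivatives are
    C^k. *)
Fixpoint Ck (R : realType) (V W : normedModType R) (k : nat)
    (D : set V) (f : V -> W) : Prop :=
  match k with
  | 0 => forall x, D x -> {for x, continuous f}
  | k'.+1 => (forall x, D x -> differentiable f x) /\
             (forall v : V, Ck k' D ('D_v f))
  end.

(** [chart_map] is only meaningful on [chart_dom], and [chart_inv] on the image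
    of [chart_dom]. *)
Record chart (R : realType) (T : Type) (m : nat) := Chart {
  chart_dom : set T;
  chart_map :> T -> 'rV[R]_m;
  chart_inv : 'rV[R]_m -> T }.

(** An atlas comes with a preferred chart around each point.  A tangent vector
    at [p] is represented by its components in the preferred chart at [p];
    [tchange] converts between charts. *)
Record atlas (R : realType) (T : Type) (m : nat) := Atlas {
  charts : set (chart R T m);
  chart_at : T -> chart R T m }.

Definition chart_image (R : realType) (T : Type) (m : nat)
    (c : chart R T m) (D : set T) : set 'rV[R]_m :=
  c @` (chart_dom c `&` D).

(** The conditions below force the image of a chart to be open and the chart
    to be a homeomorphism onto it. *)
Record smooth_manifold (R : realType) (n : nat) (M : topologicalType)
    (A : atlas R M n) : Prop := SmoothManifold {
  manifold_hausdorff : hausdorff_space M;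
  manifold_second_countable : @second_countable M;
  chart_at_charts : forall p, charts A (chart_at A p);
  chart_at_dom : forall p, chart_dom (chart_at A p) p;
  chart_dom_open : forall c, charts A c -> open (chart_dom c);
  chart_image_open : forall c, charts A c -> open (chart_image c setT);
  chart_mapK : forall c, charts A c ->
    forall p, chart_dom c p -> chart_inv c (c p) = p;
  chart_map_continuous : forall c, charts A c ->
    forall p, chart_dom c p -> {for p, continuous c};
  chart_inv_continuous : forall c, charts A c ->
    forall x, chart_image c setT x -> {for x, continuous (chart_inv c)};
  charts_compatible : forall c c', charts A c -> charts A c' ->
    forall k, Ck k (chart_image c (chart_dom c')) (c' \o chart_inv c) }.

Section Calculus.
Context {R : realType} {T : Type} {m : nat} (A : atlas R T m).

(** The components with respect to [c'] of the tangent vector at [p] whose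
    components with respect to [c] are [v]. *)
Definition tchange (c c' : chart R T m) (p : T) (v : 'rV[R]_m) : 'rV[R]_m :=
  'D_v (c' \o chart_inv c) (c p).

Definition Ck_fun (k : nat) (D : set T) (f : T -> R) : Prop :=
  forall c, charts A c ->
    Ck k (chart_image c D) (f \o chart_inv c : 'rV[R]_m -> R^o).

Definition smooth_fun (D : set T) (f : T -> R) : Prop :=
  forall k, Ck_fun k D f.

(** The components of the vector field [X] in the chart [c], as functions of
    the coordinates. *)
Definition local_field (X : T -> 'rV[R]_m) (c : chart R T m)
    (x : 'rV[R]_m) : 'rV[R]_m :=
  let p := chart_inv c x in tchange (chart_at A p) c p (X p).

Definition smooth_field (D : set T) (X : T -> 'rV[R]_m) : Prop :=
  forall c, charts A c ->
  forall k, Ck k (chart_image c D) (local_field X c).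

Definition dfun (f : T -> R) (X : T -> 'rV[R]_m) (p : T) : R :=
  let c := chart_at A p in
  'D_(X p) (f \o chart_inv c : 'rV[R]_m -> R^o) (c p).

(** In any chart [X, Y]^i = X . Y^i - Y . X^i; here in the preferred chart at
    [p], where the components of [X] and [Y] at [p] are [X p] and [Y p]. *)
Definition bracket (X Y : T -> 'rV[R]_m) (p : T) : 'rV[R]_m :=
  let c := chart_at A p in
  'D_(X p) (local_field Y c) (c p) - 'D_(Y p) (local_field X c) (c p).

(** Exterior derivative of a 1-form, with the convention that has no
    factor 1/2. *)
Definition d1form (theta : (T -> 'rV[R]_m) -> T -> R)
    (X Y : T -> 'rV[R]_m) (p : T) : R :=
  dfun (theta Y) X p - dfun (theta X) Y p - theta (bracket X Y) p.

(** The Frolicher-Nijenhuis bracket of two vector 1-forms. *)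
Definition fn_bracket11 (K N : (T -> 'rV[R]_m) -> (T -> 'rV[R]_m))
    (X Y : T -> 'rV[R]_m) : T -> 'rV[R]_m :=
  bracket (K X) (N Y) + bracket (N X) (K Y)
  + K (N (bracket X Y)) + N (K (bracket X Y))
  - K (bracket (N X) Y) - K (bracket X (N Y))
  - N (bracket (K X) Y) - N (bracket X (K Y)).

(** The Frolicher-Nijenhuis bracket of a vector 1-form and a vector field. *)
Definition fn_bracket10 (K : (T -> 'rV[R]_m) -> (T -> 'rV[R]_m))
    (Z X : T -> 'rV[R]_m) : T -> 'rV[R]_m :=
  bracket (K X) Z - K (bracket X Z).

End Calculus.

(** [TVec p v] is the vector at [p] with components [v] in the preferred
    chart at [p]. *)
Record tbundle (R : realType) (M : Type) (n : nat) (A : atlas R M n) := TVec {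
  base : M;
  vec : 'rV[R]_n }.

(** The chart (x^i, y^i) of the tangent bundle induced by a chart (x^i). *)
Definition tchart (R : realType) (M : Type) (n : nat) (A : atlas R M n)
    (c : chart R M n) : chart R (tbundle A) (n + n) :=
  {| chart_dom := [set u | chart_dom c (base u)];
     chart_map := fun u =>
       row_mx (c (base u)) (tchange (chart_at A (base u)) c (base u) (vec u));
     chart_inv := fun z =>
       let p := chart_inv c (lsubmx z) in
       TVec A p (tchange c (chart_at A p) p (rsubmx z)) |}.

Definition tatlas (R : realType) (M : Type) (n : nat) (A : atlas R M n) :
    atlas R (tbundle A) (n + n) :=
  {| charts := [set tchart A c | c in charts A];
     chart_at := fun u => tchart A (chart_at A (base u)) |}.

Section Finsler.
Context {R : realType} {M : Type} {n : nat} {A : atlas R M n}.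

Local Notation TM := (tbundle A).
Local Notation field := (TM -> 'rV[R]_(n + n)).

Definition slit : set TM := [set u | vec u != 0].

Definition slit_field (X : field) : Prop := smooth_field (tatlas A) slit X.

Definition pullback (s : M -> R) (u : TM) : R := s (base u).

(** [row_mx a b] stands for a^i d/dx^i + b^i d/dy^i. *)
Definition J (X : field) : field := fun u => row_mx 0 (lsubmx (X u)).

Definition liouville : field := fun u => row_mx 0 (vec u).

Definition vertical (Z : field) : Prop := forall u, slit u -> lsubmx (Z u) = 0.

Definition scale (f : TM -> R) (X : field) : field := fun u => f u *: X u.

Definition d (f : TM -> R) (X : field) : TM -> R := dfun (tatlas A) f X.

Definition dJ (f : TM -> R) (X : field) : TM -> R := d f (J X).

Definition lie (X Y : field) : field := bracket (tatlas A) X Y.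

Definition energy (L : TM -> R) (u : TM) : R := 2^-1 * L u ^+ 2.

(** g_ij(u) = 1/2 (d/dy^i) (d/dy^j) L^2, in the preferred chart at [base u]. *)
Definition metric (L : TM -> R) (u : TM) : 'M[R]_n :=
  let c := chart_at (tatlas A) u in
  let L2 : 'rV[R]_(n + n) -> R^o := fun z => L (chart_inv c z) ^+ 2 in
  let dy i : 'rV[R]_(n + n) := row_mx 0 (delta_mx 0 i) in
  \matrix_(i, j) (2^-1 * 'D_(dy i) ('D_(dy j) L2) (c u)).

Definition posdef (g : 'M[R]_n) : Prop :=
  forall w : 'rV[R]_n, w != 0 -> 0 < (w *m g *m w^T) 0 0.

(** C^1 regularity on the whole of TM is required of the energy rather than of
    [L]: a nonzero nonnegative positively 1-homogeneous function such as a norm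
    is never differentiable along the zero section. *)
Record finsler (L : TM -> R) : Prop := Finsler {
  finsler_ge0 : forall u, 0 <= L u;
  finsler_zero : forall p, L (TVec A p 0) = 0;
  finsler_smooth : smooth_fun (tatlas A) slit L;
  finsler_C1 : Ck_fun (tatlas A) 1 setT (energy L);
  finsler_homogeneous : forall u, slit u -> d L liouville u = L u;
  finsler_posdef : forall u, slit u -> posdef (metric L u) }.

Definition conformal (L Lt : TM -> R) (s : M -> R) : Prop :=
  forall u, slit u ->
    metric Lt u = expR (2 * pullback s u) *: metric L u.

Definition Omega (L : TM -> R) : field -> field -> TM -> R :=
  d1form (tatlas A) (dJ (energy L)).

Definition canonical_spray (L : TM -> R) (G : field) : Prop :=
  slit_field G /\
  forall X, slit_field X ->
  forall u, slit u -> Omega L G X u = - d (energy L) X u.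

Definition barthel (G : field) : field -> field := fn_bracket10 (tatlas A) J G.

Definition hproj (G : field) (X : field) : field :=
  2^-1 *: (X + barthel G X).

Definition vproj (G : field) (X : field) : field :=
  2^-1 *: (X - barthel G X).

Definition curvature (G : field) (X Y : field) : field :=
  - (2^-1 *: fn_bracket11 (tatlas A) (hproj G) (hproj G) X Y).

(** [gb u] is the metric on the vertical space at [u]; its values on
    non-vertical vectors are irrelevant. *)
Definition vertical_metric (L : TM -> R)
    (gb : TM -> 'rV[R]_(n + n) -> 'rV[R]_(n + n) -> R) : Prop :=
  forall Y Z, slit_field Y -> slit_field Z ->
  forall u, slit u -> gb u (J Y u) (J Z u) = Omega L (J Y) Z u.

Definition vertical_gradient
    (gb : TM -> 'rV[R]_(n + n) -> 'rV[R]_(n + n) -> R)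
    (s : TM -> R) (Z : field) : Prop :=
  [/\ slit_field Z, vertical Z &
   forall Y, slit_field Y ->
   forall u, slit u -> d s Y u = gb u (Z u) (J Y u)].

Definition conformal_form (L : TM -> R) (G : field) (s : TM -> R)
    (grad : field) (X : field) : field :=
  scale (d s X) liouville
  + scale (d s G) (J X)
  - scale (dJ (energy L) X) grad
  - scale (energy L) (fn_bracket10 (tatlas A) J grad X).

Definition alternate (Theta : field -> field -> field) (X Y : field) : field :=
  Theta X Y - Theta Y X.

End Finsler.

(* Main.v *)
From HB Require Import structures.
Require Import Defs.
From mathcomp Require Import all_boot all_order all_algebra.
From mathcomp Require Import all_classical all_reals all_analysis.
From mathcomp Require Import ring lra.

Set Implicit Arguments.
Unset Strict Implicit.
Unset Printing Implicit Defensive.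

Import Order.TTheory GRing.Theory Num.Theory.
Import numFieldNormedType.Exports.

Local Open Scope classical_set_scope.
Local Open Scope ring_scope.

(** The Barthel connection of the second metric is that of the first minus
    twice the form LL, so that its horizontal and vertical projectors are
    h - LL and v + LL. The curvature of a Barthel connection is -v[hX, hY]: its
    horizontal projector is idempotent and kills vertical fields, and brackets
    of vertical fields are vertical ([curvatureE]). Inserting h - LL and v + LL
    and expanding gives the formula, because LL has vertical values and kills
    vertical fields ([vertical_conformal_form], [conformal_form_vertical]).

    The relation between the connections ([barthel_conformal]) follows from
    that between the canonical sprays, Gt = G - 2 sigma_1 C + 2 E grad
    ([conformal_spray]), by the Leibniz rule for [J, f Z]. For the sprays, the
    energies satisfy Et = exp(2 sigma) E, as the energy is half the metric
    evaluated at y ([energy_metric]). In a chart, dd_J E (W, X) is the second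
    derivative of E along W and JX minus that along X and JW ([Omega_hess]).
    On vertical X the equation of the canonical spray forces JG = C, by Euler's
    identity and the positivity of the metric; on the other X it then
    determines the vertical components of G ([spray_hess]). Both sides of the
    relation between the sprays solve the equation for Et.

    The canonical spray and the vertical gradient are defined by testing with
    fields that are smooth on the whole slit tangent bundle. That there are
    enough of them to obtain pointwise equations is
    [slit_field_through], which rests on bump functions and on the Hausdorff
    property.

    Brackets of brackets are computed in a fixed chart around a point. This is
    legitimate because the bracket is natural under changes of charts
    ([local_bracket]), a consequence of the symmetry of second derivatives
    ([derive_sym]), and because changes of tangent charts are tangent maps, so
    that J and C have the same components in all of them ([local_J],
    [local_liouville]). *)

(** * Directional derivatives *)

Section Differentiation.
Context {R : realType}.

Lemma near_eq_differentiable (V W : normedModType R) (f g : V -> W) (a : V) :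
  (\near a, f a = g a) -> differentiable f a -> differentiable g a.
Proof.
move=> fg df; have [dc Hf] := (diff_locallyP _ _).1 df.
have fga : f a = g a by exact: (nbhs_singleton fg).
have Hg : g \o shift a = cst (g a) + 'd f a +o_ 0 id.
  apply/eqaddoP => e e0; move/eqaddoP : Hf => /(_ e e0).
  have : \forall h \near (0 : V), f (h + a) = g (h + a).
    by move: fg; rewrite (near_shift 0) subr0.
  apply: filterS2 => h fgh.
  by rewrite /= !fctE /= fgh -fga.
by apply/diff_locallyP; rewrite (diff_unique dc Hg).
Qed.

Lemma derive_comp (U V W : normedModType R) (f : U -> V) (g : V -> W) (x v : U) :
  differentiable f x -> differentiable g (f x) ->
  'D_v (g \o f) x = 'D_('D_v f x) g (f x).
Proof.
move=> df dg; rewrite !deriveE//; first by rewrite diff_comp.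
exact: differentiable_comp.
Qed.

Lemma derive_lin (V W : normedModType R) (f : V -> W) (x u v : V) (a : R) :
  differentiable f x -> 'D_(a *: u + v) f x = a *: 'D_u f x + 'D_v f x.
Proof. by move=> df; rewrite !deriveE// linearP. Qed.

Lemma derive_dirB (V W : normedModType R) (f : V -> W) (x u v : V) :
  differentiable f x -> 'D_(u - v) f x = 'D_u f x - 'D_v f x.
Proof. by move=> df; rewrite !deriveE// linearB. Qed.

Lemma derive_dirZ (V W : normedModType R) (f : V -> W) (x v : V) (a : R) :
  differentiable f x -> 'D_(a *: v) f x = a *: 'D_v f x.
Proof. by move=> df; rewrite !deriveE// linearZ. Qed.

(** This reduces derivatives along varying vectors to partial derivatives. *)
Lemma derive_dir_sum (m : nat) (W : normedModType R) (f : 'rV[R]_m -> W) (x v : 'rV[R]_m) :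
  differentiable f x -> 'D_v f x = \sum_i v 0 i *: 'D_(delta_mx 0 i) f x.
Proof.
move=> df; rewrite deriveE// {1}(row_sum_delta v) linear_sum.
by apply: eq_bigr => i _; rewrite linearZ deriveE.
Qed.

Lemma derive_coord (m : nat) (V : normedModType R) (f : V -> 'rV[R]_m) (x v : V) j :
  differentiable f x -> 'D_v (fun z => f z 0 j : R^o) x = ('D_v f x) 0 j.
Proof. by move=> df; rewrite derive_mx ?mxE//; apply: diff_derivable. Qed.

Lemma differentiable_rowP (m : nat) (V : normedModType R) (f : V -> 'rV[R]_m) (x : V) :
  differentiable f x <-> forall j, differentiable (fun z => f z 0 j : R^o) x.
Proof.
split=> [df j|df].
  exact: (differentiable_comp df (differentiable_coord _ _ _)).
have -> : f = \sum_j (fun z => f z 0 j *: (delta_mx 0 j : 'rV[R]_m)).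
  by apply/funext => z; rewrite fct_sumE -row_sum_delta.
apply: differentiable_sum => j.
exact: differentiableZl.
Qed.

Lemma linear_rV_continuous (m : nat) (W : normedModType R) (f : {linear 'rV[R]_m -> W}) :
  continuous f.
Proof.
have -> : (f : 'rV[R]_m -> W) = \sum_(j < m) (fun z : 'rV[R]_m => z 0 j *: f (delta_mx 0 j)).
  apply/funext => z; rewrite fct_sumE {1}(row_sum_delta z) linear_sum.
  by apply: eq_bigr => i _; rewrite linearZ.
move=> x; apply: differentiable_continuous.
by apply: differentiable_sum => j; apply: differentiableZl; exact: differentiable_coord.
Qed.

Lemma linear_rV_differentiable (m : nat) (W : normedModType R) (f : {linear 'rV[R]_m -> W}) x :
  differentiable f x.
Proof. by apply: linear_differentiable; apply: linear_rV_continuous. Qed.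

Lemma linear_rV_derive (m : nat) (W : normedModType R) (f : {linear 'rV[R]_m -> W}) x v :
  'D_v f x = f v.
Proof.
rewrite deriveE; last exact: linear_rV_differentiable.
by rewrite diff_lin//; exact: linear_rV_continuous.
Qed.

End Differentiation.

(** * Symmetry of second derivatives *)

Section Schwarz.
Context {R : realType}.

Lemma is_derive_line (V : normedModType R) (f : V -> R^o) (y v : V) (s : R) :
  differentiable f (s *: v + y) ->
  is_derive s 1 (fun s => f (s *: v + y) : R) ('D_v f (s *: v + y)).
Proof.
move=> df.
have H : is_diff s (fun s : R^o => s *: v + y) (fun s => s *: v + 0).
  by apply: is_diffD.
have dl : differentiable (fun s : R^o => s *: v + y) s by exact: ex_diff.
have dd : differentiable (f \o (fun s : R^o => s *: v + y)) s.
  exact: differentiable_comp.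
apply: DeriveDef; first exact: diff_derivable.
have := @derive_comp R R^o V R^o _ f s 1 dl df.
by rewrite (deriveE _ dl) diff_val addr0 scale1r.
Qed.

(** The mean value theorem, applied in the direction [v] and then in the
    direction [w]. *)
Lemma second_difference (V : normedModType R) (D : set V) (f : V -> R^o)
    (x v w : V) (t : R) : 0 < t -> open D -> Ck 2 D f ->
  (forall s r, 0 <= s <= t -> 0 <= r <= t -> D (x + s *: v + r *: w)) ->
  exists s r, [/\ 0 <= s <= t, 0 <= r <= t &
    f (x + t *: v + t *: w) - f (x + t *: v) - f (x + t *: w) + f x
    = t * t * 'D_w ('D_v f) (x + s *: v + r *: w)].
Proof.
move=> t0 oD [df ddf] inD.
have [ddf1 _] := ddf v.
have t00 : 0 <= t <= t by rewrite lexx ltW.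
have z00 : 0 <= (0 : R) <= t by rewrite lexx ltW.
pose F (s : R) : R := f (s *: v + (x + t *: w)) - f (s *: v + x).
have dF s : 0 <= s <= t -> is_derive s 1 F
    ('D_v f (s *: v + (x + t *: w)) - 'D_v f (s *: v + x)).
  move=> hs; apply: is_deriveB; apply: is_derive_line; apply: df.
    by rewrite addrCA addrA; apply: inD.
  by have := inD s 0 hs z00; rewrite scale0r addr0 addrC.
have [||s hs Fs] := @MVT _ F
    (fun s => 'D_v f (s *: v + (x + t *: w)) - 'D_v f (s *: v + x)) _ _ t0.
- by move=> s; rewrite in_itv/= => /andP[s0 st]; apply: dF; rewrite !ltW.
- apply: derivable_within_continuous => s; rewrite in_itv/= => hs.
  by have [] := dF s hs.
have {}hs : 0 <= s <= t by move: hs; rewrite in_itv/= => /andP[s0 st]; rewrite !ltW.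
pose K (r : R) : R := 'D_v f (r *: w + (x + s *: v)).
have dK r : 0 <= r <= t -> is_derive r 1 K
    ('D_w ('D_v f) (r *: w + (x + s *: v))).
  move=> hr; apply: is_derive_line; apply: ddf1.
  by rewrite addrC; apply: inD.
have [||r hr Kr] := @MVT _ K
    (fun r => 'D_w ('D_v f) (r *: w + (x + s *: v))) _ _ t0.
- by move=> r; rewrite in_itv/= => /andP[s0 st]; apply: dK; rewrite !ltW.
- apply: derivable_within_continuous => r; rewrite in_itv/= => hr.
  by have [] := dK r hr.
exists s, r; split => //.
  by move: hr; rewrite in_itv/= => /andP[s0 st]; rewrite !ltW.
move: Fs Kr; rewrite /F /K !subr0 !scale0r !add0r.
have xC (z y : V) : z + (x + y) = x + z + y by rewrite addrCA addrA.
rewrite !xC (addrC (t *: v) x) (addrC (s *: v) x) (addrAC x (t *: w)).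
rewrite (addrAC x (r *: w)) => Fs Kr.
transitivity (f (x + t *: v + t *: w) - f (x + t *: v) - (f (x + t *: w) - f x)).
  by rewrite opprB addrA addrAC.
by rewrite Fs Kr -[LHS]mulrA mulrC.
Qed.

Lemma small_multiple (d c : R) : 0 < d -> 0 <= c -> exists2 t, 0 < t & t * c < d.
Proof.
move=> d0 c0; have n0 : 0 < c + 1 by rewrite ltr_wpDl.
exists (d / (c + 1)); first exact: divr_gt0.
by rewrite mulrAC -mulrA gtr_pMr// ltr_pdivrMr// mul1r ltrDl.
Qed.

(** Symmetry of second derivatives: both mixed derivatives are limits of the
    same second difference quotient. *)
Lemma derive_sym (V : normedModType R) (D : set V) (f : V -> R^o) (x v w : V) :
  open D -> D x -> Ck 2 D f -> 'D_v ('D_w f) x = 'D_w ('D_v f) x.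
Proof.
move=> oD Dx Cf; apply/eqP; rewrite -subr_eq0 -normr_le0.
apply/ler_addgt0Pr => e e0; rewrite add0r.
have [df ddf] := Cf.
have c1 := ((ddf w).2 v x Dx); have c2 := ((ddf v).2 w x Dx).
have e20 : 0 < e / 2 by rewrite divr_gt0.
have h1 : \forall t \near x, `|'D_v ('D_w f) x - 'D_v ('D_w f) t| < e / 2.
  exact: ((cvgrPdist_lt _ _).1 c1).
have h2 : \forall t \near x, `|'D_w ('D_v f) x - 'D_w ('D_v f) t| < e / 2.
  exact: ((cvgrPdist_lt _ _).1 c2).
have h3 : \forall z \near x, D z by exact: open_nbhs_nbhs.
have /nbhs_ballP[d /= d0 hd] : \forall z \near x, [/\ D z,
    `|'D_v ('D_w f) x - 'D_v ('D_w f) z| < e / 2 &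
    `|'D_w ('D_v f) x - 'D_w ('D_v f) z| < e / 2].
  exact: (@filterS3 _ _ (nbhs_filter x) _ _ _ _ (fun z a b c => And3 a b c) h3 h1 h2).
have [t t0 td] := small_multiple d0 (addr_ge0 (normr_ge0 v) (normr_ge0 w)).
have inb s r : 0 <= s <= t -> 0 <= r <= t -> ball x d (x + s *: v + r *: w).
  move=> /andP[s0 st] /andP[r0 rt].
  rewrite -ball_normE /ball_/= -addrA opprD addrA subrr sub0r normrN.
  apply: le_lt_trans (ler_normD _ _) _; rewrite !normrZ !ger0_norm//.
  by apply: le_lt_trans td; rewrite mulrDr lerD// ler_wpM2r.
have [s [r [hs hr E1]]] := @second_difference V D f x v w t t0 oD Cf
  (fun p q hp hq => let: And3 a _ _ := hd _ (inb p q hp hq) in a).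
have inb' p q : 0 <= p <= t -> 0 <= q <= t -> ball x d (x + p *: w + q *: v).
  by move=> a b; rewrite addrAC; apply: inb.
have [s' [r' [hs' hr' E2]]] := @second_difference V D f x w v t t0 oD Cf
  (fun p q hp hq => let: And3 a _ _ := hd _ (inb' p q hp hq) in a).
have E : 'D_w ('D_v f) (x + s *: v + r *: w) = 'D_v ('D_w f) (x + s' *: w + r' *: v).
  have tt : t * t != 0 by rewrite mulf_neq0// gt_eqF.
  apply: (mulfI tt); apply: (etrans (esym E1)); apply: (etrans _ E2).
  rewrite (addrAC x (t *: w)); congr (_ + _); exact: addrAC.
have [_ _ i1] := hd _ (inb _ _ hs hr).
have [_ i2 _] := hd _ (inb' _ _ hs' hr').
move: i1 i2; rewrite E.
move: ('D_v ('D_w f) (x + s' *: w + r' *: v)) ('D_v ('D_w f) x) ('D_w ('D_v f) x).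
move=> q a b.
move=> i1 i2.
apply: le_trans (ler_distD q _ _) _.
rewrite [leRHS]splitr.
by apply: lerD; apply: ltW; last rewrite distrC.
Qed.
End Schwarz.

(* Derivatives are limits, but below they are used only through their rules. *)
#[local] Opaque derive.

(** * Functions of class C^k *)

Section CkTheory.
Context {R : realType}.

Lemma open_near (T : topologicalType) (D : set T) (P : T -> Prop) (x : T) :
  open D -> D x -> (forall z, D z -> P z) -> \forall z \near x, P z.
Proof.
move=> oD Dx PD; have := open_nbhs_nbhs (conj oD Dx).
by apply: filterS => z /PD.
Qed.

Lemma Ck_ext (V W : normedModType R) k (D : set V) (f g : V -> W) :
  open D -> (forall x, D x -> f x = g x) -> Ck k D f -> Ck k D g.
Proof.
move=> oD; elim: k f g => [|k IH] f g fg /=.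
  move=> cf x Dx; have fgx : \forall z \near x, f z = g z by exact: open_near fg.
  have cfx : f @ x --> g x by rewrite -(fg x Dx); exact: cf.
  apply: cvg_trans cfx; exact: near_eq_cvg.
move=> [df ddf]; split=> [x Dx|v].
  by apply: near_eq_differentiable (df x Dx); exact: open_near fg.
apply: IH (ddf v) => x Dx; apply: near_eq_derive; exact: open_near fg.
Qed.

Lemma Ck_sub (V W : normedModType R) k (D D' : set V) (f : V -> W) :
  D' `<=` D -> Ck k D f -> Ck k D' f.
Proof.
move=> sD; elim: k f => [|k IH] f /=; first by move=> cf x /sD /cf.
by move=> [df ddf]; split=> [x /sD/df|v] //; apply: IH.
Qed.

Lemma CkW (V W : normedModType R) k (D : set V) (f : V -> W) :
  Ck k.+1 D f -> Ck k D f.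
Proof.
elim: k f => [|k IH] f /=.
  by move=> [df _] x /df; exact: differentiable_continuous.
by move=> [df ddf]; split=> // v; apply: IH; exact: ddf.
Qed.

(** The extension by zero of a cut-off field is given by different formulas near
    different points. *)
Lemma Ck_local (V W : normedModType R) k (D : set V) (f : V -> W) :
  (forall x, D x -> exists D', [/\ open D', D' x & Ck k D' f]) -> Ck k D f.
Proof.
elim: k f => [|k IH] f /= H.
  by move=> x /H [D' [_ D'x]]; apply.
split=> [x /H [D' [_ D'x [+ _]]]|v]; first by apply.
by apply: IH => x /H [D' [? ? [_ ?]]]; exists D'.
Qed.

Lemma Ck_cst (V W : normedModType R) k (D : set V) (c : W) :
  Ck k D (cst c : V -> W).
Proof.
elim: k c => [|k IH] c /=; first by move=> x _; exact: cst_continuous.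
split=> [x _|v]; first exact: differentiable_cst.
have -> : 'D_v (cst c : V -> W) = cst 0 by apply/funext => x; exact: derive_cst.
exact: IH.
Qed.

Lemma CkD (V W : normedModType R) k (D : set V) (f g : V -> W) :
  open D -> Ck k D f -> Ck k D g -> Ck k D (fun x => f x + g x).
Proof.
move=> oD; elim: k f g => [|k IH] f g /=.
  by move=> cf cg x Dx; apply: cvgD; [exact: cf|exact: cg].
move=> [df ddf] [dg ddg]; split=> [x Dx|v].
  by apply: (@differentiableD _ _ _ f g); [exact: df|exact: dg].
apply: Ck_ext (IH _ _ (ddf v) (ddg v)) => // x Dx.
by rewrite -deriveD//; apply: diff_derivable; [exact: df|exact: dg].
Qed.

Lemma Ck_sum (V W : normedModType R) k (D : set V) n (F : 'I_n -> V -> W) :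
  open D -> (forall i, Ck k D (F i)) -> Ck k D (fun x => \sum_i F i x).
Proof.
move=> oD; elim: n F => [|n IH] F CF.
  by apply: Ck_ext (Ck_cst k D 0) => // x _; rewrite big_ord0.
apply: Ck_ext (CkD oD (IH _ (fun i => CF (widen_ord (leqnSn n) i))) (CF ord_max)) => //.
by move=> x Dx; rewrite big_ord_recr.
Qed.

Lemma CkM (V : normedModType R) k (D : set V) (f g : V -> R^o) :
  open D -> Ck k D f -> Ck k D g -> Ck k D (fun x => f x * g x : R^o).
Proof.
move=> oD; elim: k f g => [|k IH] f g.
  by move=> cf cg x Dx; apply: cvgM; [exact: cf|exact: cg].
move=> Cf Cg; have [df ddf] := Cf; have [dg ddg] := Cg.
split=> [x Dx|v].
  by apply: (@differentiableM _ _ f g); [exact: df|exact: dg].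
apply: Ck_ext (CkD oD (IH _ _ (CkW Cf) (ddg v)) (IH _ _ (CkW Cg) (ddf v))) => // x Dx.
by rewrite [RHS]deriveM//; apply: diff_derivable; [exact: df|exact: dg].
Qed.

Lemma Ck_rowP (m : nat) (V : normedModType R) k (D : set V) (f : V -> 'rV[R]_m) :
  open D ->
  Ck k D f <-> forall j, Ck k D (fun x => f x 0 j : R^o).
Proof.
move=> oD; elim: k f => [|k IH] f; split.
- move=> cf j x Dx; exact: (continuous_comp (cf x Dx) (@coord_continuous R 1 m 0 j (f x))).
- move=> cf; have C j : Ck 0 D (fun x => f x 0 j *: (delta_mx 0 j : 'rV[R]_m)).
    by move=> x Dx; apply: cvgZr_tmp; exact: cf.
  by apply: Ck_ext (Ck_sum oD C) => // x _; rewrite -row_sum_delta.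
- move=> [df ddf] j; split=> [x /df/differentiable_rowP|v]; first exact.
  apply: Ck_ext ((IH _).1 (ddf v) j) => // x Dx.
  by rewrite [RHS]derive_coord//; exact: df.
- move=> cf; have df x : D x -> differentiable f x.
    by move=> Dx; apply/differentiable_rowP => j; have [+ _] := cf j; apply.
  split=> // v; apply/IH => j; have [_ ddf] := cf j.
  apply: Ck_ext (ddf v) => // x Dx.
  by rewrite derive_coord//; exact: df.
Qed.

Lemma CkZ (m : nat) (V : normedModType R) k (D : set V) (a : V -> R^o) (f : V -> 'rV[R]_m) :
  open D -> Ck k D a -> Ck k D f -> Ck k D (fun x => a x *: f x).
Proof.
move=> oD Ca Cf; apply/Ck_rowP => // j.
have := (Ck_rowP _ _ oD).1 Cf j => Cfj.
by apply: Ck_ext (CkM oD Ca Cfj) => // x _; rewrite mxE.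
Qed.

Lemma Ck_linear (m : nat) (W : normedModType R) k (D : set 'rV[R]_m)
  (f : {linear 'rV[R]_m -> W}) : Ck k D f.
Proof.
case: k => [|k] /=; first by move=> x _; exact: linear_rV_continuous.
split=> [x _|v]; first exact: linear_rV_differentiable.
have -> : 'D_v f = cst (f v) by apply/funext => x; exact: linear_rV_derive.
exact: Ck_cst.
Qed.

Lemma Ck_id (m : nat) k (D : set 'rV[R]_m) : Ck k D (fun x : 'rV[R]_m => x).
Proof. exact: (@Ck_linear m _ k D idfun). Qed.

Lemma Ck_coord (m : nat) k (D : set 'rV[R]_m) j :
  open D -> Ck k D (fun x : 'rV[R]_m => x 0 j : R^o).
Proof. by move=> oD; exact: ((Ck_rowP k (fun x => x) oD).1 (Ck_id k D)). Qed.

(** In the induction the chain rule writes D_v (g o f) as the sum of the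
    products of the components of D_v f with the partial derivatives of [g]
    composed with [f]. *)
Lemma Ck_comp1 (m p : nat) k (D : set 'rV[R]_m) (D' : set 'rV[R]_p)
    (f : 'rV[R]_m -> 'rV[R]_p) (g : 'rV[R]_p -> R^o) :
  open D -> (forall x, D x -> D' (f x)) -> Ck k D f -> Ck k D' g ->
  Ck k D (fun x => g (f x)).
Proof.
move=> oD fD; elim: k g => [|k IH] g.
  by move=> cf cg x Dx; exact: (continuous_comp (cf x Dx) (cg _ (fD x Dx))).
move=> Cf Cg; have [df ddf] := Cf; have [dg ddg] := Cg.
split=> [x Dx|v].
  exact: (differentiable_comp (df x Dx) (dg _ (fD x Dx))).
have C i : Ck k D (fun x => ('D_v f x) 0 i * 'D_(delta_mx 0 i) g (f x) : R^o).
  exact: (CkM oD ((Ck_rowP _ _ oD).1 (ddf v) i) (IH _ (CkW Cf) (ddg _))).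
apply: Ck_ext (Ck_sum oD C) => // x Dx.
rewrite [RHS](derive_comp v (df x Dx) (dg _ (fD x Dx))).
by rewrite (derive_dir_sum _ (dg _ (fD x Dx))).
Qed.

Lemma Ck_comp (m p q : nat) k (D : set 'rV[R]_m) (D' : set 'rV[R]_p)
    (f : 'rV[R]_m -> 'rV[R]_p) (g : 'rV[R]_p -> 'rV[R]_q) :
  open D -> open D' -> (forall x, D x -> D' (f x)) -> Ck k D f -> Ck k D' g ->
  Ck k D (fun x => g (f x)).
Proof.
move=> oD oD' fD Cf /(Ck_rowP _ _ oD') Cg; apply/Ck_rowP => // j.
exact: Ck_comp1 Cf (Cg j).
Qed.

Lemma Ck_derive (m p : nat) k (D : set 'rV[R]_m) (f : 'rV[R]_m -> 'rV[R]_p)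
    (X : 'rV[R]_m -> 'rV[R]_m) :
  open D -> Ck k.+1 D f -> Ck k D X -> Ck k D (fun x => 'D_(X x) f x).
Proof.
move=> oD [df ddf] CX.
have C i : Ck k D (fun x => X x 0 i *: 'D_(delta_mx 0 i) f x).
  exact: (CkZ oD ((Ck_rowP _ _ oD).1 CX i) (ddf _)).
apply: Ck_ext (Ck_sum oD C) => // x Dx.
by rewrite [RHS]derive_dir_sum//; exact: df.
Qed.

Lemma Ck_derive1 (m : nat) k (D : set 'rV[R]_m) (f : 'rV[R]_m -> R^o)
    (X : 'rV[R]_m -> 'rV[R]_m) :
  open D -> Ck k.+1 D f -> Ck k D X -> Ck k D (fun x => 'D_(X x) f x).
Proof.
move=> oD [df ddf] CX.
have C i : Ck k D (fun x => X x 0 i * 'D_(delta_mx 0 i) f x : R^o).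
  exact: (CkM oD ((Ck_rowP _ _ oD).1 CX i) (ddf _)).
apply: Ck_ext (Ck_sum oD C) => // x Dx.
by rewrite [RHS]derive_dir_sum//; exact: df.
Qed.

(** The product rule for the sum of the products Y_i D_i f; in the second-order
    term [Y] is frozen at [x]. *)
Lemma derive_derive1 (m : nat) (D : set 'rV[R]_m)
    (f : 'rV[R]_m -> R^o) (Y : 'rV[R]_m -> 'rV[R]_m) (x v : 'rV[R]_m) :
  open D -> D x -> Ck 2 D f -> differentiable Y x ->
  'D_v (fun z => 'D_(Y z) f z) x = 'D_v ('D_(Y x) f) x + 'D_('D_v Y x) f x.
Proof.
move=> oD Dx [df ddf] dY.
have dYi i : derivable (fun z => Y z 0 i : R^o) x v.
  by apply: diff_derivable; exact: ((differentiable_rowP _ _).1 dY i).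
have dfi i : derivable ('D_(delta_mx 0 i) f) x v.
  by apply: diff_derivable; have [+ _] := ddf (delta_mx 0 i); apply.
have -> : 'D_v (fun z => 'D_(Y z) f z) x =
    'D_v (\sum_i (fun z => Y z 0 i : R^o) * 'D_(delta_mx 0 i) f) x.
  apply: near_eq_derive; apply: (open_near oD Dx) => z Dz.
  by rewrite derive_dir_sum ?fct_sumE//; exact: df.
have -> : 'D_v ('D_(Y x) f) x = 'D_v (\sum_i (Y x 0 i \*: 'D_(delta_mx 0 i) f)) x.
  apply: near_eq_derive; apply: (open_near oD Dx) => z Dz.
  by rewrite derive_dir_sum ?fct_sumE//; exact: df.
rewrite derive_sum => [|i]; last exact: derivableM.
rewrite derive_sum => [|i]; last exact: derivableZ.
rewrite (derive_dir_sum _ (df x Dx)) -big_split/=.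
apply: eq_bigr => i _; rewrite deriveM// deriveZ// derive_coord//.
by congr (_ + _); exact: mulrC.
Qed.

Lemma derive_derive (m p : nat) (D : set 'rV[R]_m)
    (f : 'rV[R]_m -> 'rV[R]_p) (Y : 'rV[R]_m -> 'rV[R]_m) (x v : 'rV[R]_m) :
  open D -> D x -> Ck 2 D f -> Ck 1 D Y ->
  'D_v (fun z => 'D_(Y z) f z) x = 'D_v ('D_(Y x) f) x + 'D_('D_v Y x) f x.
Proof.
move=> oD Dx Cf CY; have [df ddf] := Cf.
have dY : differentiable Y x by have [+ _] := CY; apply.
have dfY : differentiable (fun z => 'D_(Y z) f z) x.
  by have [+ _] := Ck_derive oD Cf CY; apply.
have ddfY : differentiable ('D_(Y x) f) x by have [+ _] := ddf (Y x); apply.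
apply/rowP => j; apply: (etrans (esym (derive_coord v j dfY))).
have rD (a b : 'rV[R]_p) : (a + b) 0 j = a 0 j + b 0 j by rewrite mxE.
apply: (etrans _ (esym (rD _ _))).
have Cj : Ck 2 D (fun z => f z 0 j : R^o) by exact: ((Ck_rowP _ _ oD).1 Cf j).
have E w z : D z -> 'D_w (fun z => f z 0 j : R^o) z = ('D_w f z) 0 j.
  by move=> Dz; rewrite derive_coord//; exact: df.
transitivity ('D_v (fun z => 'D_(Y z) (fun z => f z 0 j : R^o) z) x).
  by apply: near_eq_derive; apply: (open_near oD Dx) => z Dz; rewrite E.
apply: (etrans (derive_derive1 v oD Dx Cj dY)); congr (_ + _).
  apply: (etrans _ (derive_coord v j ddfY)).
  by apply: near_eq_derive; apply: (open_near oD Dx) => z Dz; rewrite E.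
by rewrite E.
Qed.

(** By [derive_sym], one component at a time. *)
Lemma derive_sym_row (m p : nat) (D : set 'rV[R]_m) (f : 'rV[R]_m -> 'rV[R]_p)
    (x v w : 'rV[R]_m) :
  open D -> D x -> Ck 2 D f -> 'D_v ('D_w f) x = 'D_w ('D_v f) x.
Proof.
move=> oD Dx Cf; have [df ddf] := Cf.
apply/rowP => j.
have Cj : Ck 2 D (fun z => f z 0 j : R^o) by exact: ((Ck_rowP _ _ oD).1 Cf j).
have E a b : ('D_a ('D_b f) x) 0 j = 'D_a ('D_b (fun z => f z 0 j : R^o)) x.
  have db : differentiable ('D_b f) x by have [+ _] := ddf b; apply.
  apply: (etrans (esym (derive_coord a j db))).
  apply: near_eq_derive; apply: (open_near oD Dx) => z Dz.
  by rewrite derive_coord//; exact: df.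
by apply: (etrans (E _ _)); apply: (etrans (derive_sym v w oD Dx Cj)).
Qed.
End CkTheory.

(** * Vector fields in the charts of an atlas *)

Lemma derive_scale (R : realType) (m : nat) (V : normedModType R) (a : V -> R^o)
    (Y : V -> 'rV[R]_m) (x v : V) :
  differentiable a x -> differentiable Y x ->
  'D_v (fun z => a z *: Y z) x = a x *: 'D_v Y x + 'D_v a x *: Y x.
Proof.
move=> da dY.
have dYi i : differentiable (fun z => Y z 0 i : R^o) x by exact: ((differentiable_rowP _ _).1 dY i).
have E i : (fun z => (a z *: Y z) 0 i : R^o) = a * (fun z => Y z 0 i : R^o).
  by apply/funext => z; rewrite mxE.
have daY : differentiable (fun z => a z *: Y z) x.
  by apply/differentiable_rowP => i; rewrite E; exact: differentiableM.
apply/rowP => i; apply: (etrans (esym (derive_coord v i daY))); rewrite E.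
have rD (b c : 'rV[R]_m) : (b + c) 0 i = b 0 i + c 0 i by rewrite mxE.
apply: (etrans _ (esym (rD _ _))).
have ha : derivable a x v by exact: diff_derivable.
have hY : derivable (fun z => Y z 0 i : R^o) x v by exact: diff_derivable.
rewrite [LHS]deriveM//.
have rZ r (c : 'rV[R]_m) : (r *: c) 0 i = r * c 0 i by rewrite mxE.
apply: (etrans _ (esym (congr2 +%R (rZ _ _) (rZ _ _)))).
by congr (_ + _); [rewrite (derive_coord v i dY)|exact: mulrC].
Qed.

(** The part of the axioms of a smooth manifold that differentiation on the
    subset [D] uses; it does not refer to a topology on [T], so that it applies
    to the tangent bundle. *)
Record regular_atlas (R : realType) (T : Type) (m : nat) (A : atlas R T m)
    (D : set T) : Prop := RegularAtlas {
  ra_at : forall p, charts A (chart_at A p);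
  ra_dom : forall p, chart_dom (chart_at A p) p;
  ra_mapK : forall c, charts A c ->
    forall p, chart_dom c p -> chart_inv c (c p) = p;
  ra_open : forall c c', charts A c -> charts A c' ->
    open (chart_image c (chart_dom c' `&` D));
  ra_compatible : forall c c', charts A c -> charts A c' ->
    forall k, Ck k (chart_image c (chart_dom c' `&` D)) (c' \o chart_inv c) }.

(** The Lie bracket of vector fields on a vector space. *)
Definition vbracket (R : realType) (m : nat) (X Y : 'rV[R]_m -> 'rV[R]_m)
    (x : 'rV[R]_m) := 'D_(X x) Y x - 'D_(Y x) X x.

Section RegularAtlas.
Context {R : realType} {T : Type} {m : nat} {A : atlas R T m} {D : set T}.
Hypothesis rA : regular_atlas A D.
Implicit Types (c : chart R T m) (p : T) (X Y Z : T -> 'rV[R]_m) (f : T -> R).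

Lemma chart_image_open_dom c : charts A c -> open (chart_image c D).
Proof.
move=> Ac; have := ra_open rA Ac Ac; congr open.
by apply/seteqP; split=> x [p [? ?] <-]; exists p => //; move: b => [].
Qed.

Lemma chart_image_mem c p (S : set T) : chart_dom c p -> S p -> chart_image c S (c p).
Proof. by move=> ? ?; exists p. Qed.

Lemma transition_differentiable c c' p : charts A c -> charts A c' ->
  chart_dom c p -> chart_dom c' p -> D p ->
  differentiable (c' \o chart_inv c) (c p).
Proof.
move=> Ac Ac' cp c'p Dp; have [+ _] := ra_compatible rA Ac Ac' 1.
by apply; apply: chart_image_mem.
Qed.

Lemma near_chart c c' p (P : 'rV[R]_m -> Prop) : charts A c -> charts A c' ->
  chart_dom c p -> chart_dom c' p -> D p ->
  (forall q, chart_dom c q -> chart_dom c' q -> D q -> P (c q)) ->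
  \forall z \near c p, P z.
Proof.
move=> Ac Ac' cp c'p Dp H.
apply: (open_near (ra_open rA Ac Ac')); first exact: chart_image_mem.
by move=> _ [q [cq [c'q Dq]] <-]; exact: H.
Qed.

Lemma tchange_trans c c' c'' p v : charts A c -> charts A c' -> charts A c'' ->
  chart_dom c p -> chart_dom c' p -> chart_dom c'' p -> D p ->
  tchange c' c'' p (tchange c c' p v) = tchange c c'' p v.
Proof.
move=> Ac Ac' Ac'' cp c'p c''p Dp; rewrite /tchange.
have E : (c' \o chart_inv c) (c p) = c' p by rewrite /= (ra_mapK rA).
rewrite -E -derive_comp; first last.
- by rewrite E; exact: transition_differentiable.
- exact: transition_differentiable.
apply: near_eq_derive; apply: (near_chart Ac Ac') => // q cq c'q Dq /=.
by rewrite !(ra_mapK rA).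
Qed.

Lemma tchange_refl c p v : charts A c -> chart_dom c p -> D p ->
  tchange c c p v = v.
Proof.
move=> Ac cp Dp; rewrite /tchange -[RHS](@derive_id _ _ (c p) v).
apply: near_eq_derive; apply: (near_chart Ac Ac) => // q cq _ Dq /=.
by rewrite (ra_mapK rA).
Qed.

Lemma tchangeP c c' p a u v : charts A c -> charts A c' ->
  chart_dom c p -> chart_dom c' p -> D p ->
  tchange c c' p (a *: u + v) = a *: tchange c c' p u + tchange c c' p v.
Proof.
by move=> *; rewrite /tchange derive_lin//; exact: transition_differentiable.
Qed.

Lemma tchangeZ c c' p a v : charts A c -> charts A c' ->
  chart_dom c p -> chart_dom c' p -> D p ->
  tchange c c' p (a *: v) = a *: tchange c c' p v.
Proof.
by move=> *; rewrite /tchange derive_dirZ//; exact: transition_differentiable.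
Qed.

Lemma local_fieldE X c p : charts A c -> chart_dom c p ->
  local_field A X c (c p) = tchange (chart_at A p) c p (X p).
Proof. by move=> Ac cp; rewrite /local_field (ra_mapK rA). Qed.

Lemma local_field_at X p : D p ->
  local_field A X (chart_at A p) (chart_at A p p) = X p.
Proof.
move=> Dp; have [h1 h2] := (ra_at rA p, ra_dom rA p).
by rewrite local_fieldE// tchange_refl.
Qed.

(** The change of chart acts on components by its derivative. Both sides are
    obtained from the preferred chart at [p] by the cocycle rule
    [tchange_trans]. *)
Lemma local_field_change X c c' p : charts A c -> charts A c' ->
  chart_dom c p -> chart_dom c' p -> D p ->
  local_field A X c' (c' p) = tchange c c' p (local_field A X c (c p)).
Proof.
move=> Ac Ac' cp c'p Dp; have [h1 h2] := (ra_at rA p, ra_dom rA p).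
by rewrite !local_fieldE// tchange_trans.
Qed.

(** The combination a X + Y covers sums and multiples at once. *)
Lemma local_fieldP X Y Z (a : T -> R) c : charts A c ->
  (forall p, D p -> Z p = a p *: X p + Y p) ->
  forall x, chart_image c D x -> local_field A Z c x =
    a (chart_inv c x) *: local_field A X c x + local_field A Y c x.
Proof.
move=> Ac E _ [p [cp Dp] <-]; have [h1 h2] := (ra_at rA p, ra_dom rA p).
by rewrite !local_fieldE// E// tchangeP// (ra_mapK rA).
Qed.

Lemma local_field_eq X Y c : charts A c -> (forall p, D p -> X p = Y p) ->
  forall x, chart_image c D x -> local_field A X c x = local_field A Y c x.
Proof.
move=> Ac E _ [p [cp Dp] <-].
by rewrite (local_fieldE X Ac cp) (local_fieldE Y Ac cp) (E p Dp).
Qed.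

Lemma smooth_field_diff X c p : smooth_field A D X -> charts A c ->
  chart_dom c p -> D p -> differentiable (local_field A X c) (c p).
Proof.
by move=> sX Ac cp Dp; have [+ _] := sX _ Ac 1; apply; exact: chart_image_mem.
Qed.

Lemma smooth_fun_diff f c p : smooth_fun A D f -> charts A c ->
  chart_dom c p -> D p -> differentiable (f \o chart_inv c : _ -> R^o) (c p).
Proof.
by move=> sf Ac cp Dp; have [+ _] := sf 1%N _ Ac; apply; exact: chart_image_mem.
Qed.

(** By the chain rule, so that the preferred chart at each point can be replaced
    by one fixed chart near a point. *)
Lemma dfunE f X c p : smooth_fun A D f -> charts A c -> chart_dom c p -> D p ->
  dfun A f X p = 'D_(local_field A X c (c p)) (f \o chart_inv c : _ -> R^o) (c p).
Proof.
move=> sf Ac cp Dp; have [h1 h2] := (ra_at rA p, ra_dom rA p).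
rewrite local_fieldE// /tchange /dfun; set c1 := chart_at A p.
have E : (c \o chart_inv c1) (c1 p) = c p by rewrite /= (ra_mapK rA).
rewrite -E -derive_comp; first last.
- by rewrite E; exact: smooth_fun_diff.
- exact: transition_differentiable.
apply: near_eq_derive; apply: (near_chart h1 Ac) => // q cq c'q Dq /=.
by rewrite !(ra_mapK rA).
Qed.

(** The two second-order terms that the change of chart produces cancel in the
    bracket, by the symmetry of second derivatives. *)
Lemma vbracket_change X Y c c' p : smooth_field A D X -> smooth_field A D Y ->
  charts A c -> charts A c' -> chart_dom c p -> chart_dom c' p -> D p ->
  vbracket (local_field A X c') (local_field A Y c') (c' p) =
  tchange c c' p (vbracket (local_field A X c) (local_field A Y c) (c p)).
Proof.
move=> sX sY Ac Ac' cp c'p Dp; set phi := c' \o chart_inv c.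
have dphi : differentiable phi (c p) by exact: transition_differentiable.
set O := chart_image c (chart_dom c' `&` D).
have oO : open O by exact: (ra_open rA Ac Ac').
have Op : O (c p) by exact: chart_image_mem.
have E : phi (c p) = c' p by rewrite /phi /= (ra_mapK rA).
have OD : O `<=` chart_image c D by move=> _ [q [? [? ?]] <-]; exists q.
have H Z W : smooth_field A D Z -> smooth_field A D W ->
    'D_(local_field A Z c' (c' p)) (local_field A W c') (c' p) =
    'D_(local_field A Z c (c p)) ('D_(local_field A W c (c p)) phi) (c p) +
    'D_('D_(local_field A Z c (c p)) (local_field A W c) (c p)) phi (c p).
  move=> sZ sW.
  rewrite (local_field_change Z Ac Ac')// -E /tchange -derive_comp//; last first.
    by rewrite E; exact: smooth_field_diff.
  rewrite -(derive_derive _ oO Op).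
  - apply: near_eq_derive; apply: (open_near oO Op) => _ [q [cq [c'q Dq]] <-].
    by rewrite /phi /= (ra_mapK rA)// (local_field_change W Ac Ac').
  - exact: (ra_compatible rA Ac Ac').
  - by apply: Ck_sub (sW _ Ac 1%N).
have S := derive_sym_row (local_field A X c (c p)) (local_field A Y c (c p)) oO
  Op (ra_compatible rA Ac Ac' 2).
rewrite /vbracket (H X Y sX sY) (H Y X sY sX) -/phi /tchange.
apply: (etrans _ (esym (derive_dirB _ _ dphi))).
have cancel (a b d e : 'rV[R]_m) : a = b -> a + d - (b + e) = d - e.
  by move=> ->; rewrite opprD addrACA subrr add0r.
exact: cancel S.
Qed.

(** The value of a bracket at a point is defined in the preferred chart of that
    point; naturality makes one chart serve a whole neighborhood, so that
    brackets can be iterated. *)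
Lemma local_bracket X Y c x : smooth_field A D X -> smooth_field A D Y ->
  charts A c -> chart_image c D x ->
  local_field A (bracket A X Y) c x = vbracket (local_field A X c) (local_field A Y c) x.
Proof.
move=> sX sY Ac [p [cp Dp] <-]; have [h1 h2] := (ra_at rA p, ra_dom rA p).
rewrite (local_fieldE _ Ac cp); apply: (etrans _ (esym (vbracket_change sX sY h1 Ac h2 cp Dp))).
by rewrite /vbracket (local_field_at X Dp) (local_field_at Y Dp).
Qed.

Lemma smooth_bracket X Y : smooth_field A D X -> smooth_field A D Y ->
  smooth_field A D (bracket A X Y).
Proof.
move=> sX sY c Ac k.
have oc := chart_image_open_dom Ac.
have C1 := Ck_derive oc (sY c Ac k.+1) (sX c Ac k).
have C2 := Ck_derive oc (sX c Ac k.+1) (sY c Ac k).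
have C := CkD oc C1 (CkZ oc (Ck_cst k _ (-1 : R^o)) C2).
apply: Ck_ext C => // x cx.
by rewrite local_bracket// /vbracket scaleN1r.
Qed.

Lemma smooth_fieldP X Y Z (a : T -> R) : smooth_fun A D a ->
  smooth_field A D X -> smooth_field A D Y ->
  (forall p, D p -> Z p = a p *: X p + Y p) -> smooth_field A D Z.
Proof.
move=> sa sX sY E c Ac k; have oc := chart_image_open_dom Ac.
apply: (Ck_ext oc) (CkD oc (CkZ oc (sa k c Ac) (sX c Ac k)) (sY c Ac k)).
by move=> x cx; rewrite (local_fieldP Ac E).
Qed.

Lemma smooth_dfun f X : smooth_fun A D f -> smooth_field A D X ->
  smooth_fun A D (dfun A f X).
Proof.
move=> sf sX k c Ac; have oc := chart_image_open_dom Ac.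
apply: (Ck_ext oc) (Ck_derive1 oc (sf k.+1 c Ac) (sX c Ac k)).
by move=> _ [p [cp Dp] <-]; rewrite /= (ra_mapK rA)// (dfunE X sf Ac).
Qed.

Lemma bracket_eq X X' Y Y' : (forall p, D p -> X p = X' p) ->
  (forall p, D p -> Y p = Y' p) -> forall p, D p -> bracket A X Y p = bracket A X' Y' p.
Proof.
move=> EX EY p Dp; have [h1 h2] := (ra_at rA p, ra_dom rA p).
have H Z Z' v : (forall q, D q -> Z q = Z' q) ->
    'D_v (local_field A Z (chart_at A p)) (chart_at A p p) =
    'D_v (local_field A Z' (chart_at A p)) (chart_at A p p).
  move=> EZ; apply: near_eq_derive.
  apply: (open_near (chart_image_open_dom h1) (chart_image_mem h2 Dp)) => x cx.
  exact: local_field_eq.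
rewrite /bracket.
rewrite (EX p Dp).
rewrite (EY p Dp).
have e1 := H X X' (Y' p) EX.
have e2 := H Y Y' (X' p) EY.
exact: (f_equal2 (fun a b => a - b) e2 e1).
Qed.

Lemma bracketC X Y p : bracket A X Y p = - bracket A Y X p.
Proof.
have E (a b : 'rV[R]_m) : a - b = - (b - a) by rewrite opprB.
by rewrite /bracket /=; exact: E.
Qed.

(** Stated for any [Z] equal to a Y + Y' on [D], as a field has no meaning off
    [D]. *)
Lemma bracket_leibniz X Y Y' Z (a : T -> R) : smooth_fun A D a ->
  smooth_field A D X -> smooth_field A D Y -> smooth_field A D Y' ->
  (forall p, D p -> Z p = a p *: Y p + Y' p) ->
  forall p, D p -> bracket A X Z p =
    a p *: bracket A X Y p + dfun A a X p *: Y p + bracket A X Y' p.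
Proof.
move=> sa sX sY sY' E p Dp; have [h1 h2] := (ra_at rA p, ra_dom rA p).
set c := chart_at A p.
have dX : differentiable (local_field A X c) (c p) by exact: (smooth_field_diff sX).
have dY : differentiable (local_field A Y c) (c p) by exact: (smooth_field_diff sY).
have dY' : differentiable (local_field A Y' c) (c p) by exact: (smooth_field_diff sY').
have da : differentiable (a \o chart_inv c : _ -> R^o) (c p).
  exact: (smooth_fun_diff sa).
have daY : differentiable (fun x => (a \o chart_inv c) x *: local_field A Y c x) (c p).
  have oc := chart_image_open_dom h1.
  have [+ _] := CkZ oc (sa 1%N _ h1) (sY _ h1 1%N).
  by apply; exact: chart_image_mem.
have DZ : 'D_(X p) (local_field A Z c) (c p) =
    'D_(X p) (fun x => (a \o chart_inv c) x *: local_field A Y c x) (c p) +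
    'D_(X p) (local_field A Y' c) (c p).
  have d1 := @diff_derivable _ _ _ _ _ (X p) daY.
  have d2 := @diff_derivable _ _ _ _ _ (X p) dY'.
  apply: (etrans _ (deriveD d1 d2)); apply: near_eq_derive.
  apply: (open_near (chart_image_open_dom h1) (chart_image_mem h2 Dp)) => x cx.
  exact: (local_fieldP h1 E).
have aK : (a \o chart_inv c) (c p) = a p by rewrite /= (ra_mapK rA).
have Yp : local_field A Y c (c p) = Y p by exact: local_field_at.
have DZ' := etrans DZ (congr1 (+%R^~ _) (derive_scale (X p) da dY)).
have DX : 'D_(Z p) (local_field A X c) (c p) =
    a p *: 'D_(Y p) (local_field A X c) (c p) + 'D_(Y' p) (local_field A X c) (c p).
  by rewrite (E p Dp); exact: derive_lin.
apply: (etrans (f_equal2 (fun u v => u - v) DZ' DX)).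
rewrite aK Yp /bracket /dfun -/c.
have alg (r s : R) (b d e g k : 'rV[R]_m) : (r *: b + s *: k + d) - (r *: e + g) =
    r *: (b - e) + s *: k + (d - g).
  rewrite scalerBr opprD -!addrA; congr (_ + _).
  by rewrite [RHS]addrCA; congr (_ + _); rewrite addrCA.
exact: alg.
Qed.

End RegularAtlas.

(** * The atlas of the tangent bundle *)

Section ProductCoordinates.
Context {R : realType} {n : nat}.
Local Notation V := 'rV[R]_(n + n).

(** In the coordinates (x, y) of a tangent chart [jmap] is the almost tangent
    structure, and [vpart] and [hlift], applied to the coordinates themselves,
    are the Liouville field (0, y) and the field (y, 0). *)
Definition jmap (z : V) : V := row_mx 0 (lsubmx z).
Definition vpart (z : V) : V := row_mx 0 (rsubmx z).
Definition hlift (z : V) : V := row_mx (rsubmx z) 0.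

Fact jmap_linear : linear jmap.
Proof.
by move=> a x y; rewrite /jmap scale_row_mx add_row_mx scaler0 addr0 linearP.
Qed.
HB.instance Definition _ := GRing.isLinear.Build R V V _ jmap jmap_linear.

Fact vpart_linear : linear vpart.
Proof.
by move=> a x y; rewrite /vpart scale_row_mx add_row_mx scaler0 addr0 linearP.
Qed.
HB.instance Definition _ := GRing.isLinear.Build R V V _ vpart vpart_linear.

Fact hlift_linear : linear hlift.
Proof.
by move=> a x y; rewrite /hlift scale_row_mx add_row_mx scaler0 addr0 linearP.
Qed.
HB.instance Definition _ := GRing.isLinear.Build R V V _ hlift hlift_linear.

Lemma Ck_row_mx (W : normedModType R) k (D : set W) (f g : W -> 'rV[R]_n) :
  open D -> Ck k D f -> Ck k D g -> Ck k D (fun x => row_mx (f x) (g x)).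
Proof.
move=> oD /(Ck_rowP _ _ oD) Cf /(Ck_rowP _ _ oD) Cg; apply/Ck_rowP => // j.
case: (splitP j) => i ji.
  have -> : j = lshift n i by apply/val_inj.
  by apply: Ck_ext (Cf i) => // x _; rewrite row_mxEl.
have -> : j = rshift n i by apply/val_inj.
by apply: Ck_ext (Cg i) => // x _; rewrite row_mxEr.
Qed.

(** The tangent map of [phi]. *)
Definition tangent_map (phi : 'rV[R]_n -> 'rV[R]_n) (z : V) : V :=
  row_mx (phi (lsubmx z)) ('D_(rsubmx z) phi (lsubmx z)).

Lemma open_lsub (O : set 'rV[R]_n) : open O -> open [set z : V | O (lsubmx z)].
Proof.
move=> oO; apply: open_comp => // x _.
apply: (@linear_rV_continuous R _ _ (@lsubmx R 1 n n)).
Qed.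

Section TangentMap.
Variables (phi : 'rV[R]_n -> 'rV[R]_n) (O : set 'rV[R]_n).
Hypotheses (oO : open O) (Cphi : forall k, Ck k O phi).
Let O' : set V := [set z | O (lsubmx z)].
Let oO' : open O'. Proof. exact: open_lsub. Qed.
Let F (z : V) := phi (lsubmx z).

Let CF k : Ck k O' F.
Proof.
apply: (@Ck_comp _ _ _ _ _ _ O (fun z => lsubmx z) phi) => //.
exact: (Ck_linear k O' (@lsubmx R 1 n n)).
Qed.

Let dF v z : O' z -> 'D_v F z = 'D_(lsubmx v) phi (lsubmx z).
Proof.
move=> Oz; have [dphi _] := Cphi 1.
have dl : differentiable (@lsubmx R 1 n n : V -> _) z by exact: linear_rV_differentiable.
apply: (etrans (derive_comp v dl (dphi _ Oz))).
by rewrite linear_rV_derive.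
Qed.

(** [phi o lsubmx], differentiated along the field [hlift], whose value at
    (x, y) is (y, 0). *)
Let tangent_mapE z : O' z -> tangent_map phi z = row_mx (F z) ('D_(hlift z) F z).
Proof. by move=> Oz; rewrite (dF _ Oz) row_mxKl. Qed.

Lemma Ck_tangent_map k : Ck k O' (tangent_map phi).
Proof.
have CD : Ck k O' (fun z => 'D_(hlift z) F z).
  by apply: Ck_derive => //; exact: Ck_linear.
apply: (Ck_ext oO' _ (Ck_row_mx oO' (CF k) CD)) => z Oz.
exact: (esym (tangent_mapE Oz)).
Qed.

Lemma derive_tangent_map_lsub z v : O (lsubmx z) ->
  lsubmx ('D_v (tangent_map phi) z) = 'D_(lsubmx v) phi (lsubmx z).
Proof.
move=> Oz; have [dT _] := Ck_tangent_map 1.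
have dl x : differentiable (@lsubmx R 1 n n : V -> _) x by exact: linear_rV_differentiable.
rewrite -(dF v Oz).
transitivity ('D_v (@lsubmx R 1 n n \o tangent_map phi) z).
  apply: (etrans (esym (linear_rV_derive (@lsubmx R 1 n n) (tangent_map phi z) _))).
  exact: (esym (derive_comp v (dT _ Oz) (dl _))).
apply: near_eq_derive; apply: (open_near oO' Oz) => x Ox /=.
by rewrite row_mxKl.
Qed.

(** The tangent map is linear in the fibers. In terms of [F] and [hlift], the
    mixed second derivative vanishes because [F] is constant along vertical
    vectors. *)
Lemma derive_tangent_map_vertical z a : O (lsubmx z) ->
  'D_(row_mx 0 a) (tangent_map phi) z = row_mx 0 ('D_a phi (lsubmx z)).
Proof.
move=> Oz; have [dT _] := Ck_tangent_map 1.
have dr x : differentiable (@rsubmx R 1 n n : V -> _) x by exact: linear_rV_differentiable.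
rewrite -[LHS]hsubmxK derive_tangent_map_lsub// row_mxKl derive0; congr row_mx.
transitivity ('D_(row_mx 0 a) (@rsubmx R 1 n n \o tangent_map phi) z).
  apply: (etrans (esym (linear_rV_derive (@rsubmx R 1 n n) (tangent_map phi z) _))).
  exact: (esym (derive_comp _ (dT _ Oz) (dr _))).
transitivity ('D_(row_mx 0 a) (fun z => 'D_(hlift z) F z) z).
  apply: near_eq_derive; apply: (open_near oO' Oz) => x Ox /=.
  by rewrite tangent_mapE// row_mxKr.
apply: (etrans (derive_derive _ oO' Oz (CF 2) (Ck_linear 1 O' hlift))).
rewrite linear_rV_derive dF// {2}/hlift row_mxKl row_mxKr.
rewrite (derive_sym_row _ _ oO' Oz (CF 2)).
rewrite (_ : 'D_(hlift z) _ z = 0) ?add0r//.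
rewrite -[RHS](derive_cst (0 : 'rV[R]_n) z (hlift z)).
apply: near_eq_derive; apply: (open_near oO' Oz) => x Ox /=.
by rewrite dF// row_mxKl derive0.
Qed.
End TangentMap.
End ProductCoordinates.

(** The domain of a change of chart is open because the inverse of a chart is
    continuous. *)
Lemma regular_manifold (R : realType) (n : nat) (M : topologicalType)
    (A : atlas R M n) : smooth_manifold A -> regular_atlas A setT.
Proof.
move=> hM; split.
- exact: (chart_at_charts hM).
- exact: (chart_at_dom hM).
- exact: (chart_mapK hM).
- move=> c c' Ac Ac'; rewrite setIT openE => _ [p [cp c'p] <-].
  have Ic : chart_image c setT (c p) by exists p.
  have cont := chart_inv_continuous hM Ac Ic.
  have n1 : \forall z \near c p, chart_dom c' (chart_inv c z).
    apply: cont; rewrite (chart_mapK hM Ac cp).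
    exact: (open_nbhs_nbhs (conj (chart_dom_open hM Ac') c'p)).
  have n2 := open_nbhs_nbhs (conj (chart_image_open hM Ac) Ic).
  apply: filterS2 n1 n2 => z + [q [cq _] qz]; rewrite -qz (chart_mapK hM Ac cq) => c'q.
  by exists q.
- by move=> c c' Ac Ac'; rewrite setIT; exact: (charts_compatible hM Ac Ac').
Qed.

Section TangentAtlas.
Context {R : realType} {M : Type} {n : nat} {A : atlas R M n}.
Hypothesis rM : regular_atlas A setT.
Local Notation TM := (tbundle A).
Implicit Types (c : chart R M n) (u : TM).

Lemma tchart_lsub c u : lsubmx (tchart A c u) = c (base u).
Proof. by rewrite /= row_mxKl. Qed.

Lemma tchart_rsub c u :
  rsubmx (tchart A c u) = tchange (chart_at A (base u)) c (base u) (vec u).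
Proof. by rewrite /= row_mxKr. Qed.

Lemma tchart_mapK c u : charts A c -> chart_dom c (base u) ->
  chart_inv (tchart A c) (tchart A c u) = u.
Proof.
move=> Ac; case: u => p w /= cp; rewrite row_mxKl row_mxKr (ra_mapK rM)//.
have [h1 h2] := (ra_at rM p, ra_dom rM p).
by rewrite (tchange_trans rM)// (tchange_refl rM).
Qed.

Lemma tchart_invK c z p : charts A c -> chart_dom c p -> c p = lsubmx z ->
  tchart A c (chart_inv (tchart A c) z) = z.
Proof.
move=> Ac cp E; rewrite /= -E (ra_mapK rM)//.
have [h1 h2] := (ra_at rM p, ra_dom rM p).
by rewrite (tchange_trans rM)// (tchange_refl rM)// E hsubmxK.
Qed.

Lemma tchange_eq0 c c' p v : charts A c -> charts A c' -> chart_dom c p ->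
  chart_dom c' p -> (tchange c c' p v == 0) = (v == 0).
Proof.
move=> Ac Ac' cp c'p; apply/eqP/eqP => [E|->]; last exact: derive0.
rewrite -(tchange_refl rM v Ac cp)// -(tchange_trans rM v Ac Ac' Ac)// E.
exact: derive0.
Qed.

Lemma tchart_image c c' : charts A c -> charts A c' ->
  chart_image (tchart A c) (chart_dom (tchart A c') `&` slit) =
  [set z | chart_image c (chart_dom c' `&` setT) (lsubmx z) /\ rsubmx z != 0].
Proof.
move=> Ac Ac'; apply/seteqP; split=> [_ [u [cu [c'u su]] <-]|z [[p [cp [c'p _]] E] z0]].
  have [h1 h2] := (ra_at rM (base u), ra_dom rM (base u)).
  split; first by rewrite tchart_lsub; exists (base u).
  by rewrite tchart_rsub tchange_eq0.
have [h1 h2] := (ra_at rM p, ra_dom rM p).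
exists (chart_inv (tchart A c) z); last exact: tchart_invK E.
rewrite /slit /= -E (ra_mapK rM)//; do 2! split => //.
by rewrite /slit /= tchange_eq0.
Qed.

(** A change of tangent charts is the tangent map of a change of charts. *)
Lemma tchart_transition c c' z : charts A c -> charts A c' ->
  chart_image c (chart_dom c' `&` setT) (lsubmx z) ->
  tchart A c' (chart_inv (tchart A c) z) = tangent_map (c' \o chart_inv c) z.
Proof.
move=> Ac Ac' [p [cp [c'p _]] E].
have [h1 h2] := (ra_at rM p, ra_dom rM p).
have K : chart_inv c (lsubmx z) = p by rewrite -E (ra_mapK rM).
have -> : chart_inv (tchart A c) z = TVec A p (tchange c (chart_at A p) p (rsubmx z)).
  by rewrite /= K.
rewrite /tangent_map; congr row_mx; first by rewrite /= K.
by apply: (etrans (tchange_trans rM _ Ac h1 Ac' cp h2 c'p I)); rewrite /tchange E.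
Qed.

Lemma regular_tangent : regular_atlas (tatlas A) slit.
Proof.
split.
- by move=> u; exists (chart_at A (base u))  => //; exact: (ra_at rM).
- by move=> u; exact: (ra_dom rM (base u)).
- by move=> _ [c Ac <-] u cu; exact: tchart_mapK.
- move=> _ _ [c Ac <-] [c' Ac' <-]; rewrite tchart_image//.
  apply: openI; first by apply: open_lsub; exact: (ra_open rM Ac Ac').
  apply: (@open_comp _ _ (@rsubmx R 1 n n) [set y | y != 0]).
    by move=> x _; apply: (@linear_rV_continuous R _ _ (@rsubmx R 1 n n)).
  have -> : [set y : 'rV[R]_n | y != 0] = ~` [set 0].
    by apply/seteqP; split=> y /=; [move/eqP|move=> /eqP].
  rewrite openC; exact: accessible_closed_set1 (hausdorff_accessible _) _.
- move=> _ _ [c Ac <-] [c' Ac' <-] k.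
  have oT : open [set z : 'rV[R]_(n + n) | chart_image c (chart_dom c' `&` setT) (lsubmx z)].
    by apply: open_lsub; exact: (ra_open rM Ac Ac').
  have C := Ck_tangent_map (ra_open rM Ac Ac') (ra_compatible rM Ac Ac') k.
  apply: (@Ck_sub _ _ _ _ [set z | chart_image c (chart_dom c' `&` setT) (lsubmx z)]).
    by rewrite tchart_image// => z [].
  apply: (Ck_ext oT _ C) => z Oz; exact: (esym (tchart_transition Ac Ac' Oz)).
Qed.

Lemma tchange_tchart c c' u v : charts A c -> charts A c' ->
  chart_dom c (base u) -> chart_dom c' (base u) ->
  tchange (tchart A c) (tchart A c') u v =
  'D_v (tangent_map (c' \o chart_inv c)) (tchart A c u).
Proof.
move=> Ac Ac' cu c'u; rewrite /tchange.
have oT : open [set z : 'rV[R]_(n + n) | chart_image c (chart_dom c' `&` setT) (lsubmx z)].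
  by apply: open_lsub; exact: (ra_open rM Ac Ac').
apply: near_eq_derive; apply: (open_near oT); first by rewrite /= row_mxKl; exists (base u).
by move=> z Oz; exact: tchart_transition.
Qed.

Lemma tchange_lsub c c' u v : charts A c -> charts A c' ->
  chart_dom c (base u) -> chart_dom c' (base u) ->
  lsubmx (tchange (tchart A c) (tchart A c') u v) = tchange c c' (base u) (lsubmx v).
Proof.
move=> Ac Ac' cu c'u; rewrite tchange_tchart//.
rewrite (derive_tangent_map_lsub (ra_open rM Ac Ac') (ra_compatible rM Ac Ac')).
  by rewrite tchart_lsub.
by rewrite tchart_lsub; exists (base u).
Qed.

Lemma tchange_vertical c c' u a : charts A c -> charts A c' ->
  chart_dom c (base u) -> chart_dom c' (base u) ->
  tchange (tchart A c) (tchart A c') u (row_mx 0 a) =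
  row_mx 0 (tchange c c' (base u) a).
Proof.
move=> Ac Ac' cu c'u; rewrite tchange_tchart//.
rewrite (derive_tangent_map_vertical (ra_open rM Ac Ac') (ra_compatible rM Ac Ac')).
  by rewrite tchart_lsub.
by rewrite tchart_lsub; exists (base u).
Qed.

Lemma tchart_at u : chart_at (tatlas A) u = tchart A (chart_at A (base u)).
Proof. by []. Qed.

Lemma vec_tchart u : rsubmx (chart_at (tatlas A) u u) = vec u.
Proof.
have [h1 h2] := (ra_at rM (base u), ra_dom rM (base u)).
by rewrite tchart_at tchart_rsub (tchange_refl rM).
Qed.

Let rT := regular_tangent.

(** A tangent map sends (0, a) to (0, D phi a) and acts on the first components
    by D phi; hence the almost tangent structure has the same expression in
    every tangent chart. *)
Lemma local_J (X : TM -> 'rV[R]_(n + n)) (c : chart R TM (n + n)) x : charts (tatlas A) c -> chart_image c slit x ->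
  local_field (tatlas A) (J X) c x = jmap (local_field (tatlas A) X c x).
Proof.
move=> [c0 Ac <-] [u [cu su] <-].
have [h1 h2] := (ra_at rM (base u), ra_dom rM (base u)).
rewrite !(local_fieldE rT)//; try by exists c0.
by rewrite tchart_at tchange_vertical// /jmap tchange_lsub.
Qed.

Lemma local_liouville (c : chart R TM (n + n)) x : charts (tatlas A) c -> chart_image c slit x ->
  local_field (tatlas A) liouville c x = vpart x.
Proof.
move=> [c0 Ac <-] [u [cu su] <-].
have [h1 h2] := (ra_at rM (base u), ra_dom rM (base u)).
rewrite (local_fieldE rT)//; last by exists c0.
by rewrite tchart_at tchange_vertical// /vpart tchart_rsub.
Qed.

Lemma smooth_J (X : TM -> 'rV[R]_(n + n)) : slit_field X -> slit_field (J X).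
Proof.
move=> sX c Ac k; have oc := chart_image_open_dom rT Ac.
apply: Ck_ext (Ck_comp oc openT _ (sX c Ac k) (Ck_linear k setT jmap)) => // x cx.
by rewrite local_J.
Qed.

Lemma smooth_liouville : slit_field (@liouville R M n A).
Proof.
move=> c Ac k; have oc := chart_image_open_dom rT Ac.
by apply: Ck_ext (Ck_linear k _ vpart) => // x cx; rewrite local_liouville.
Qed.

Lemma smooth_pullback (s : M -> R) : smooth_fun A setT s ->
  smooth_fun (tatlas A) slit (pullback s).
Proof.
move=> ss k _ [c Ac <-].
have Ac' : charts (tatlas A) (tchart A c) by exists c.
have oc := chart_image_open_dom rT Ac'.
apply: (Ck_comp1 oc _ (Ck_linear k _ (@lsubmx R 1 n n)) (ss k c Ac)).
by move=> _ [u [cu su] <-]; exists (base u) => //; exact: esym (tchart_lsub c u).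
Qed.

End TangentAtlas.

(** * Vector fields through a given vector *)

Section Flat.
Context {R : realType}.

(** exp(-1/t) / t^j extended by zero to t <= 0; this family is closed under
    differentiation. *)
Definition flat (j : nat) (t : R) : R :=
  if 0 < t then t^-1 ^+ j * expR (- t^-1) else 0.

Lemma flat_ge0 j t : 0 <= flat j t.
Proof.
rewrite /flat; case: ifP => // t0.
by rewrite mulr_ge0 ?expR_ge0// exprn_ge0// invr_ge0 ltW.
Qed.

(** From exp x >= x^(j+1) / (j+1)!, for x = 1/t. *)
Lemma flat_le j t : 0 <= t -> flat j t <= j.+1`!%:R * t.
Proof.
move=> t0; rewrite /flat; case: ifP => [tp|_]; last by rewrite mulr_ge0.
have i0 : 0 < t^-1 by rewrite invr_gt0.
have := expR_ge1Dxn j (ltW i0) => H.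
rewrite expRN -(ler_pM2r (expR_gt0 (t^-1))) mulfVK ?gt_eqF ?expR_gt0//.
have fp : 0 < j.+1`!%:R :> R by rewrite ltr0n fact_gt0.
apply: (@le_trans _ _ (j.+1`!%:R * t * (t^-1 ^+ j.+1 / j.+1`!%:R))).
  by rewrite exprS le_eqVlt; apply/orP; left; apply/eqP; field; rewrite !gt_eqF.
rewrite ler_pM2l ?mulr_gt0//; apply: le_trans H.
by rewrite lerDr.
Qed.

(** At 0 the difference quotient is the next function of the family, which
    [flat_le] bounds by a multiple of t. *)
Lemma is_derive_flat j (t : R) :
  is_derive t 1 (flat j : R -> R) (flat j.+2 t - j%:R * flat j.+1 t).
Proof.
have [t0|t0|t0] := ltgtP t 0.
- have -> : flat j.+2 t - j%:R * flat j.+1 t = 0.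
    by rewrite /flat ltNge (ltW t0)/= mulr0 subr0.
  apply: (@near_eq_is_derive _ _ _ (cst 0)).
  near=> s; rewrite /flat ltNge (_ : s <= 0)//; apply/ltW.
  by near: s; exact: lt_nbhsl.
- have tn0 : t != 0 by rewrite gt_eqF.
  apply: (@near_eq_is_derive _ _ _ (fun s : R => s^-1 ^+ j * expR (- s^-1))).
    near=> s; rewrite /flat (_ : 0 < s)//.
    by near: s; exact: lt_nbhsr.
  have dV : is_derive t 1 (fun s : R => s^-1) (- (t^-1 ^+ 2)).
    have did : derivable (id : R -> R) t 1 by exact: derivable_id.
    apply: DeriveDef; first exact: (derivableV tn0 did).
    by rewrite (deriveV tn0 did) derive_id /= exprVn; exact: mulr1.
  have dVj : is_derive t 1 (fun s : R => s^-1 ^+ j) (j%:R * t^-1 ^+ j.-1 * - (t^-1 ^+ 2)).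
    by have := @is_deriveX R R (fun s : R => s^-1) j t 1 _ dV; rewrite exprfctE.
  have dN : is_derive t 1 (fun s : R => - s^-1) (t^-1 ^+ 2).
    by apply: is_derive_eq; rewrite opprK.
  have dE : is_derive t 1 (fun s : R => expR (- s^-1)) (expR (- t^-1) * t^-1 ^+ 2).
    exact: (@is_derive1_comp R expR (fun s => - s^-1) t _ _ (is_derive_expR _) dN).
  have dM := @is_deriveM R R (fun s : R => s^-1 ^+ j) (fun s : R => expR (- s^-1)) t 1 _ _ dVj dE.
  apply: (is_derive_eq dM); rewrite /flat t0 /GRing.scale /=.
  case: j {dVj dM} => [|j]; rewrite ?expr0 ?exprS /=; ring.
- rewrite t0; have -> : flat j.+2 0 - j%:R * flat j.+1 0 = 0.
    by rewrite /flat ltxx mulr0 subr0.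
  suff H : (fun h : R => h^-1 *: (flat j (h *: 1 + 0) - flat j 0)) @ 0^' --> (0 : R).
    apply: DeriveDef; first by apply/cvg_ex; exists 0.
    exact: cvg_lim.
  apply/cvgrPdist_lt => e e0.
  have [d d0 de] := small_multiple e0 (ler0n R j.+2`!).
  near=> h; have h0 : h != 0 by near: h; exact: nbhs_dnbhs_neq.
  have hd : `|h| < d by near: h; exact: dnbhs0_lt.
  have -> : flat j 0 = 0 by rewrite /flat ltxx.
  rewrite sub0r normrN subr0 addr0 /GRing.scale /= mulr1.
  have [hp|hn] := ltP 0 h; last first.
    have hF : (0 < h) = false by exact: le_gtF.
    by rewrite /flat hF mulr0 normr0.
  have -> : h^-1 * flat j h = flat j.+1 h by rewrite /flat hp exprS mulrA.
  rewrite ger0_norm ?flat_ge0//; apply: (le_lt_trans (flat_le j.+1 (ltW hp))).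
  apply: lt_trans de; rewrite mulrC ltr_pM2r ?ltr0n ?fact_gt0//.
  by apply: le_lt_trans hd; exact: ler_norm.
Unshelve. all: by end_near. Qed.

Lemma Ck_flat (V : normedModType R) (D : set V) (q : V -> R^o) k j :
  open D -> (forall k, Ck k D q) -> Ck k D (fun x => flat j (q x) : R^o).
Proof.
move=> oD Cq; have [dq ddq] := Cq 1%N.
have df i x : differentiable (flat i : R^o -> R^o) (q x).
  by have [+ _] := is_derive_flat i (q x); move/derivable1_diffP.
have dfq i x : D x -> differentiable (fun x => flat i (q x) : R^o) x.
  by move=> Dx; exact: (differentiable_comp (dq x Dx) (df i x)).
elim: k j => [|k IH] j /=; first by move=> x Dx; exact: differentiable_continuous (dfq j x Dx).
split=> [x Dx|v]; first exact: dfq.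
have C := CkM oD (CkD oD (IH j.+2) (CkM oD (Ck_cst k D (- j%:R : R^o)) (IH j.+1))) (proj2 (Cq k.+1) v).
apply: (Ck_ext oD _ C) => x Dx.
apply: (etrans _ (esym (derive_comp v (dq x Dx) (df j x)))).
have [_ E] := is_derive_flat j (q x).
have -> : 'D_v q x = 'D_v q x *: (1 : R^o) by rewrite /GRing.scale /= mulr1.
rewrite (derive_dirZ _ _ (df j x)) E /GRing.scale /= mulr1 mulrC.
by rewrite mulNr.
Qed.
End Flat.

Section TestFields.
Context {R : realType} {n : nat}.

(** The function exp(-1/t) of t = r^2 - |x - x0|^2; here the Euclidean norm is
    used because its square is a polynomial, while the conclusion is for the
    maximum norm. *)
Lemma bump (x0 : 'rV[R]_n) (r : R) : 0 < r -> exists chi : 'rV[R]_n -> R^o,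
  [/\ forall k D, open D -> Ck k D chi, chi x0 != 0 &
      forall x, chi x != 0 -> `|x0 - x| <= r].
Proof.
move=> r0.
pose q (x : 'rV[R]_n) : R^o := r ^+ 2 + \sum_i (- 1) * ((x 0 i - x0 0 i) * (x 0 i - x0 0 i)).
have Cq k D : open D -> Ck k D q.
  move=> oD; apply: (CkD oD (Ck_cst k D (r ^+ 2 : R^o))).
  apply: Ck_sum => // i.
  apply: (CkM oD (Ck_cst k D (-1 : R^o))).
  have C := CkD oD (Ck_coord k i oD) (Ck_cst k D (- x0 0 i : R^o)).
  exact: (CkM oD C C).
exists (fun x => flat 0 (q x)); split.
- by move=> k D oD; apply: Ck_flat => // k'; exact: Cq.
- have -> : q x0 = r ^+ 2.
    by rewrite /q big1 ?addr0// => i _; rewrite subrr !mulr0.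
  by rewrite /flat exprn_gt0// expr0 mul1r gt_eqF// expR_gt0.
- move=> x; rewrite /flat; case: ifP => [qx _|_]; last by rewrite eqxx.
  rewrite [leLHS]/Num.Def.normr/= mx_normrE (bigmax_le _ (ltW r0))//= => -[i j] _.
  rewrite (ord1 i) !mxE /= distrC -(ler_pXn2r (_ : 0 < 2)%N) ?nnegrE// ?(ltW r0)//.
  rewrite real_normK ?num_real// ltW//; move: qx; rewrite /q -mulr_sumr mulN1r subr_gt0.
  apply: le_lt_trans; rewrite (bigD1 j)//= -expr2 lerDl sumr_ge0// => k _.
  by rewrite -expr2 sqr_ge0.
Qed.

Context {M : topologicalType} {A : atlas R M n}.
Hypothesis hM : smooth_manifold A.
Local Notation TM := (tbundle A).

(** The field is constant in a chart, cut off by a bump function. The support of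
    the bump function is compact, hence closed in the Hausdorff space [M], so
    that the extension by zero is smooth. *)
Lemma slit_field_through (u : TM) (w : 'rV[R]_(n + n)) : slit u ->
  exists2 X : TM -> 'rV[R]_(n + n), slit_field X & X u = w.
Proof.
move=> su; have rM := regular_manifold hM; have rT := regular_tangent rM.
set c := chart_at A (base u).
have [Ac cu] : charts A c /\ chart_dom c (base u) by split; [exact: ra_at rM _|exact: ra_dom rM _].
have ATc : charts (tatlas A) (tchart A c) by exists c.
have oI := chart_image_open hM Ac.
have Iu : chart_image c setT (c (base u)) by exists (base u).
have /nbhs_ballP[e /= e0 eI] : nbhs (c (base u)) (chart_image c setT).
  exact: (open_nbhs_nbhs (conj oI Iu)).
have r0 : 0 < e / 2 by rewrite divr_gt0.
have [chi [Cchi chi0 chiS]] := bump (c (base u)) r0.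
set B := [set x : 'rV[R]_n | `|c (base u) - x| <= e / 2].
have BI : B `<=` chart_image c setT.
  move=> x Bx; apply: eI; rewrite -ball_normE /ball_/=.
  apply: le_lt_trans Bx _; rewrite ltr_pdivrMr// ltr_pMr// ltr1n//.
have cB : compact B.
  apply: bounded_closed_compact; last exact: closed_closed_ball_.
  exists (`|c (base u)| + e / 2); split; first exact: num_real.
  move=> M' M'e x Bx; apply: le_trans (ltW M'e).
  by rewrite -lerBlDl; apply: le_trans Bx; rewrite distrC; exact: lerB_dist.
have clK : closed (chart_inv c @` B).
  apply: compact_closed; first exact: manifold_hausdorff hM.
  apply: continuous_compact => //; apply: continuous_in_subspaceT => x.
  rewrite inE => /BI Ix; exact: (chart_inv_continuous hM Ac Ix).
(* The factor chi (c (base u)) normalizes the cut-off at [u]. *)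
pose X (q : TM) : 'rV[R]_(n + n) := if `[< chart_dom c (base q) >] then
  (chi (c (base q)) / chi (c (base u))) *: tchange (tchart A c) (chart_at (tatlas A) q) q w else 0.
exists X; last first.
  rewrite /X asboolT// mulfV// scale1r; exact: (tchange_refl rT).
have Xout q : ~ (chart_inv c @` B) (base q) -> X q = 0.
  move=> NK; rewrite /X; case: asboolP => // cq.
  have [->|/chiS Bq] := eqVneq (chi (c (base q))) 0; first by rewrite mul0r scale0r.
  by case: NK; exists (c (base q)) => //; exact: (ra_mapK rM).
move=> _ [c' Ac' <-] k; apply: Ck_local => _ [q [c'q sq] <-].
have ATc' : charts (tatlas A) (tchart A c') by exists c'.
have [cq|ncq] := pselect (chart_dom c (base q)).
  have oO := ra_open rT ATc' ATc.
  exists (chart_image (tchart A c') (chart_dom (tchart A c) `&` slit)); split => //.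
    by exists q.
  have oO' := ra_open rT ATc ATc'.
  have C1 := ra_compatible rT ATc' ATc k.
  have C2 := proj2 (ra_compatible rT ATc ATc' k.+1) w.
  have TO z : chart_image (tchart A c') (chart_dom (tchart A c) `&` slit) z ->
      chart_image (tchart A c) (chart_dom (tchart A c') `&` slit)
        ((tchart A c \o chart_inv (tchart A c')) z).
    move=> [p [c'p [cp sp]] <-]; exists p; first by split.
    exact: (congr1 (chart_map (tchart A c)) (esym (ra_mapK rT ATc' c'p))).
  have C3 := Ck_comp oO oO' TO C1 C2.
  have C4 := Ck_comp oO openT (fun _ _ => I) C1 (Ck_linear k setT (@lsubmx R 1 n n)).
  have C5 := Ck_comp1 oO (fun _ _ => I) C4 (Cchi k setT openT).
  have C6 := CkZ oO (CkM oO C5 (Ck_cst k _ ((chi (c (base u)))^-1 : R^o))) C3.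
  apply: (Ck_ext oO _ C6) => _ [p [c'p [cp sp]] <-].
  have [h1 h2] := (ra_at rT p, ra_dom rT p).
  have K : chart_inv (tchart A c') (tchart A c' p) = p by exact: (ra_mapK rT ATc' c'p).
  have TX : tchange (tchart A c) (tchart A c') p w =
      'D_w (tchart A c' \o chart_inv (tchart A c)) (tchart A c p) by [].
  have Xp : X p = (chi (c (base p)) / chi (c (base u))) *:
      tchange (tchart A c) (chart_at (tatlas A) p) p w.
    by rewrite /X; case: asboolP.
  have lc : lsubmx (tchart A c p) = c (base p) by exact: tchart_lsub.
  apply: esym; apply: (etrans (local_fieldE rT _ ATc' c'p)); rewrite Xp.
  apply: (etrans (tchangeZ rT _ _ h1 ATc' h2 c'p sp)).
  apply: (etrans (congr1 _ (tchange_trans rT w ATc h1 ATc' cp h2 c'p sp))).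
  pose g y : 'rV[R]_(n + n) := ((chi (lsubmx y) * (chi (c (base u)))^-1 : R^o) *:
    'D_w (tchart A c' \o chart_inv (tchart A c)) y).
  have K' : (tchart A c \o chart_inv (tchart A c')) (tchart A c' p) = tchart A c p.
    exact: (congr1 (chart_map (tchart A c)) K).
  apply: (etrans _ (congr1 g (esym K'))).
  have gE := congr1 (fun z => (chi z * (chi (c (base u)))^-1 : R^o) *:
    'D_w (tchart A c' \o chart_inv (tchart A c)) (tchart A c p)) lc.
  exact: (esym gE).
pose U := [set y | chart_image c' setT y /\ ~ (chart_inv c @` B) (chart_inv c' y)].
have oU : open U.
  rewrite openE => y [Iy NKy].
  have nK : nbhs (chart_inv c' y) (~` (chart_inv c @` B)).
    by apply: open_nbhs_nbhs; split => //; exact: closed_openC.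
  have n1 : nbhs y (chart_inv c' @^-1` (~` (chart_inv c @` B))).
    exact: (chart_inv_continuous hM Ac' Iy nK).
  have n2 := open_nbhs_nbhs (conj (chart_image_open hM Ac') Iy).
  exact: (filterI n2 n1).
have oI' := chart_image_open_dom rT ATc'.
exists (chart_image (tchart A c') slit `&` [set z | U (lsubmx z)]); split.
- by apply: openI => //; exact: open_lsub.
- split; first by exists q.
  rewrite /= /U tchart_lsub /= (ra_mapK rM)//; split; first by exists (base q).
  move=> [y By yq]; apply: ncq; have [p [cp _] py] := BI y By.
  by rewrite -yq -py (ra_mapK rM).
- apply: (Ck_ext _ _ (Ck_cst k _ 0)).
    by apply: openI => //; exact: open_lsub.
  move=> _ [[p [c'p sp] <-] [_]]; rewrite tchart_lsub (ra_mapK rM)// => NK.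
  rewrite (local_fieldE rT)// (Xout _ NK).
  exact: (esym (derive0 _ _)).
Qed.
End TestFields.

(** * Horizontal and vertical components of brackets *)

Section SplitVectors.
Context {R : realType} {n : nat}.
Implicit Types v w : 'rV[R]_(n + n).

Lemma jmap_eq0 v : (jmap v == 0) = (lsubmx v == 0).
Proof.
apply/eqP/eqP => [/(congr1 rsubmx)|v0]; first by rewrite row_mxKr linear0.
by rewrite /jmap v0 row_mx0.
Qed.

Lemma jmapK v : jmap (jmap v) = 0.
Proof. by rewrite /jmap row_mxKl row_mx0. Qed.

Lemma jmap_hlift v : jmap (hlift v) = vpart v.
Proof. by rewrite /jmap /hlift row_mxKl. Qed.

Lemma jmap_vpart v : jmap (vpart v) = 0.
Proof. by rewrite /jmap /vpart row_mxKl row_mx0. Qed.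

Lemma vpart_vertical v : jmap v = 0 -> vpart v = v.
Proof.
by move=> /eqP; rewrite jmap_eq0 => /eqP v0; rewrite /vpart -{2}[v]hsubmxK v0.
Qed.

Lemma vpart_jmap v : vpart (jmap v) = jmap v.
Proof. by rewrite vpart_vertical// jmapK. Qed.
End SplitVectors.

Section TangentCalculus.
Context {R : realType} {M : Type} {n : nat} {A : atlas R M n}.
Hypothesis rM : regular_atlas A setT.
Local Notation TM := (tbundle A).
Local Notation field := (TM -> 'rV[R]_(n + n)).
Let rT : regular_atlas (tatlas A) slit := regular_tangent rM.
Implicit Types (X Y Z V G : field) (u : TM) (f : TM -> R).

Definition dcoord u Z (v : 'rV[R]_(n + n)) : 'rV[R]_(n + n) :=
  'D_v (local_field (tatlas A) Z (chart_at (tatlas A) u)) (chart_at (tatlas A) u u).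

Lemma lie_dcoord X Z u : lie X Z u = dcoord u Z (X u) - dcoord u X (Z u).
Proof. by []. Qed.

Lemma near_slit u (P : 'rV[R]_(n + n) -> Prop) : slit u ->
  (forall x, chart_image (chart_at (tatlas A) u) slit x -> P x) ->
  \forall x \near chart_at (tatlas A) u u, P x.
Proof.
move=> su; apply: (open_near (chart_image_open_dom rT (ra_at rT u))).
exact: (chart_image_mem (ra_dom rT u) su).
Qed.

Lemma dcoord_eq X Y u v : slit u -> (forall u, slit u -> X u = Y u) ->
  dcoord u X v = dcoord u Y v.
Proof.
move=> su E; apply: near_eq_derive; apply: (near_slit su) => x cx.
exact: (local_field_eq rT (ra_at rT u) E).
Qed.

(** The almost tangent structure has constant components in a tangent chart. *)
Lemma dcoord_J Z u v : slit u -> slit_field Z -> dcoord u (J Z) v = jmap (dcoord u Z v).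
Proof.
move=> su sZ; have [h1 h2] := (ra_at rT u, ra_dom rT u).
have dZ := smooth_field_diff sZ h1 h2 su.
apply: esym; apply: (etrans (esym (linear_rV_derive jmap
  (local_field (tatlas A) Z (chart_at (tatlas A) u) (chart_at (tatlas A) u u)) _))).
apply: (etrans (esym (derive_comp v dZ (linear_rV_differentiable jmap _)))).
apply: near_eq_derive; apply: (near_slit su) => x cx.
exact: (esym (local_J rM Z h1 cx)).
Qed.

Lemma dcoord_liouville u v : slit u -> dcoord u liouville v = vpart v.
Proof.
move=> su; rewrite -[RHS](linear_rV_derive vpart (chart_at (tatlas A) u u)).
apply: near_eq_derive; apply: (near_slit su) => x cx.
exact: (local_liouville rM (ra_at rT u) cx).
Qed.

Lemma local_field0 (c : chart R TM (n + n)) x : local_field (tatlas A) (0 : field) c x = 0.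
Proof. exact: derive0. Qed.

Lemma dcoord0 u v : slit u -> dcoord u (0 : field) v = 0.
Proof.
move=> su; rewrite -[RHS](derive_cst (0 : 'rV[R]_(n + n)) (chart_at (tatlas A) u u) v).
by apply: near_eq_derive; apply: (near_slit su) => x cx; exact: local_field0.
Qed.

Lemma J_lie X Z u : slit u -> slit_field X -> slit_field Z ->
  J (lie X Z) u = dcoord u (J Z) (X u) - dcoord u (J X) (Z u).
Proof.
move=> su sX sZ; rewrite !dcoord_J// -linearB.
by rewrite -lie_dcoord.
Qed.

Lemma verticalP Z : vertical Z <-> (forall u, slit u -> J Z u = 0).
Proof.
split=> H u su; first by apply/eqP; rewrite (_ : J Z u = jmap (Z u))// jmap_eq0 H.
by have /eqP := H u su; rewrite (_ : J Z u = jmap (Z u))// jmap_eq0 => /eqP.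
Qed.

Lemma vertical_J X : vertical (J X).
Proof. by apply/verticalP => u su; exact: jmapK. Qed.

(** By [J_lie], J [X, Z] involves only derivatives of J X and J Z. *)
Lemma vertical_lie X Z : slit_field X -> slit_field Z -> vertical X ->
  vertical Z -> vertical (lie X Z).
Proof.
move=> sX sZ /verticalP vX /verticalP vZ; apply/verticalP => u su.
by rewrite J_lie// (dcoord_eq (Y := 0) _ su vX) (dcoord_eq (Y := 0) _ su vZ) !dcoord0// subrr.
Qed.

Definition spray G := forall u, slit u -> J G u = liouville u.

(** This identity makes the Barthel connection of a spray an almost product
    structure with vertical fields as eigenspace for -1. *)
Lemma J_lie_spray V G u : slit u -> slit_field V -> slit_field G ->
  vertical V -> spray G -> J (lie V G) u = V u.
Proof.
move=> su sV sG /verticalP vV hG.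
rewrite J_lie// (dcoord_eq (Y := 0) _ su vV) (dcoord_eq _ su hG) dcoord0// subr0.
by rewrite dcoord_liouville// vpart_vertical//; exact: vV.
Qed.

(** The terms that contain derivatives of [X] cancel because J C = 0. *)
Lemma fn_bracket_liouville X u : slit u -> slit_field X ->
  fn_bracket10 (tatlas A) J liouville X u = J X u.
Proof.
move=> su sX; have sC := smooth_liouville rM.
have C0 u' : slit u' -> J liouville u' = (0 : field) u' by move=> _; rewrite /J row_mxKl row_mx0.
have -> : fn_bracket10 (tatlas A) J liouville X u = lie (J X) liouville u - J (lie X liouville) u by [].
rewrite J_lie// lie_dcoord (dcoord_eq _ su C0) dcoord0// dcoord_liouville// sub0r opprK.
by rewrite subrK; exact: vpart_jmap.
Qed.

Lemma local_pullback (s : M -> R) u v x : smooth_fun A setT s ->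
  chart_image (chart_at (tatlas A) u) slit x ->
  'D_v (pullback s \o chart_inv (chart_at (tatlas A) u) : _ -> R^o) x =
  'D_(lsubmx v) (s \o chart_inv (chart_at A (base u)) : _ -> R^o) (lsubmx x).
Proof.
move=> ss [q [cq sq] <-]; have Ac := ra_at rM (base u).
set c := chart_at A (base u); set z := chart_at (tatlas A) u q.
have lz : lsubmx z = c (base q) by exact: tchart_lsub.
have ds : differentiable (s \o chart_inv c : _ -> R^o) (lsubmx z).
  by rewrite lz; exact: (smooth_fun_diff ss Ac cq I).
have dl : differentiable (@lsubmx R 1 n n : 'rV[R]_(n + n) -> 'rV[R]_n) z.
  exact: linear_rV_differentiable.
have H := @derive_comp R _ _ R^o (@lsubmx R 1 n n : _ -> _) (s \o chart_inv c) z v dl ds.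
apply: (etrans H); congr ('D_ _ _ _).
exact: linear_rV_derive.
Qed.

(** A pullback is constant along the fibers. *)
Lemma local_pullback_vertical (s : M -> R) u v x : smooth_fun A setT s ->
  chart_image (chart_at (tatlas A) u) slit x -> jmap v = 0 ->
  'D_v (pullback s \o chart_inv (chart_at (tatlas A) u) : _ -> R^o) x = 0.
Proof.
by move=> ss cx /eqP; rewrite jmap_eq0 local_pullback// => /eqP ->; exact: derive0.
Qed.

Lemma d_local f X u : d f X u = 'D_(X u) (f \o chart_inv (chart_at (tatlas A) u) : _ -> R^o)
  (chart_at (tatlas A) u u).
Proof. by []. Qed.

Lemma local_d f X u x : smooth_fun (tatlas A) slit f ->
  chart_image (chart_at (tatlas A) u) slit x ->
  d f X (chart_inv (chart_at (tatlas A) u) x) =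
  'D_(local_field (tatlas A) X (chart_at (tatlas A) u) x)
    (f \o chart_inv (chart_at (tatlas A) u) : _ -> R^o) x.
Proof.
move=> sf [q [cq sq] <-]; have Ac := ra_at rT u.
rewrite (ra_mapK rT Ac cq); exact: (dfunE rT _ sf Ac).
Qed.

Lemma d_vertical_pullback (s : M -> R) V u : smooth_fun A setT s -> slit u ->
  vertical V -> d (pullback s) V u = 0.
Proof.
move=> ss su /verticalP vV; rewrite d_local; apply: local_pullback_vertical => //.
  exact: (chart_image_mem (ra_dom rT u) su).
exact: vV.
Qed.

(** sigma_1 = y^i d_i sigma for every spray [G], and its vertical derivative
    recovers d sigma. *)
Lemma d_J_spray_pullback (s : M -> R) G X u : smooth_fun A setT s -> slit u ->
  slit_field G -> spray G -> slit_field X ->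
  d (d (pullback s) G) (J X) u = d (pullback s) X u.
Proof.
move=> ss su sG hG sX; have sp := smooth_pullback rM ss.
set c := chart_at (tatlas A) u; have [h1 h2] := (ra_at rT u, ra_dom rT u).
have oI := chart_image_open_dom rT h1; have Iu := chart_image_mem h2 su.
set s' := (pullback s \o chart_inv c : _ -> R^o).
have Cs : Ck 2 (chart_image c slit) s' by exact: (sp 2%N _ h1).
have [ds _] := Cs.
rewrite !d_local -/c -/s'.
transitivity ('D_(J X u) (fun x => 'D_(hlift x) s' x) (c u)).
  apply: near_eq_derive; apply: (near_slit su) => x cx.
  apply: (etrans (local_d G sp cx)); rewrite -/c -/s' !local_pullback//; congr ('D_ _ _ _).
  have E : jmap (local_field (tatlas A) G c x) = jmap (hlift x).
    rewrite jmap_hlift -(local_J rM G h1 cx) -(local_liouville rM h1 cx).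
    exact: (local_field_eq rT h1 hG).
  by have [_] := eq_row_mx E.
have dh : differentiable (hlift : _ -> 'rV[R]_(n + n)) (c u) by exact: linear_rV_differentiable.
apply: (etrans (derive_derive1 _ oI Iu Cs dh)).
have -> : 'D_(J X u) ('D_(hlift (c u)) s') (c u) = 0.
  apply: (etrans (derive_sym _ _ oI Iu Cs)).
  rewrite -[RHS](derive_cst (0 : R^o) (c u) (hlift (c u))).
  apply: near_eq_derive; apply: (near_slit su) => x cx.
  by apply: local_pullback_vertical => //; exact: jmapK.
have e1 : 'D_(J X u) hlift (c u) = hlift (J X u) by exact: linear_rV_derive.
have e2 : lsubmx (hlift (J X u)) = lsubmx (X u) by rewrite /hlift /J row_mxKl row_mxKr.
apply: (etrans (add0r _)); rewrite e1.
apply: (etrans (local_pullback _ ss Iu)); rewrite e2.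
exact: (esym (local_pullback _ ss Iu)).
Qed.

End TangentCalculus.

(** * The Hessian of the energy *)

Section Energy.
Context {R : realType} {M : Type} {n : nat} {A : atlas R M n}.
Hypothesis rM : regular_atlas A setT.
Local Notation TM := (tbundle A).
Local Notation field := (TM -> 'rV[R]_(n + n)).
Let rT : regular_atlas (tatlas A) slit := regular_tangent rM.
Implicit Types (X Y Z V W G : field) (u : TM) (E F : TM -> R) (v w : 'rV[R]_(n + n)).

Definition local_fun E u : 'rV[R]_(n + n) -> R^o :=
  E \o chart_inv (chart_at (tatlas A) u).

Definition fderive E u v : R := 'D_v (local_fun E u) (chart_at (tatlas A) u u).

(** Second derivatives in a chart are not tensorial; intrinsic are the
    restriction to vertical vectors and the combination in [Omega_hess]. *)
Definition hess E u v w : R :=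
  'D_v ('D_w (local_fun E u)) (chart_at (tatlas A) u u).

Let Iu u : slit u -> chart_image (chart_at (tatlas A) u) slit (chart_at (tatlas A) u u).
Proof. by move=> su; exact: (chart_image_mem (ra_dom rT u) su). Qed.

Let oI u : open (chart_image (chart_at (tatlas A) u) slit).
Proof. exact: (chart_image_open_dom rT (ra_at rT u)). Qed.

Let CE E u k : smooth_fun (tatlas A) slit E ->
  Ck k (chart_image (chart_at (tatlas A) u) slit) (local_fun E u).
Proof. by move=> sE; exact: (sE k _ (ra_at rT u)). Qed.

Let local_fun_diff E u x : smooth_fun (tatlas A) slit E ->
  chart_image (chart_at (tatlas A) u) slit x -> differentiable (local_fun E u) x.
Proof. by move=> sE; have [+ _] := CE u 1 sE; apply. Qed.

Let local_fun_diff2 E u x v : smooth_fun (tatlas A) slit E ->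
  chart_image (chart_at (tatlas A) u) slit x -> differentiable ('D_v (local_fun E u)) x.
Proof. by move=> sE; have [_ H] := CE u 2 sE; have [+ _] := H v; apply. Qed.

Lemma fderiveP E u a v w : smooth_fun (tatlas A) slit E -> slit u ->
  fderive E u (a *: v + w) = a * fderive E u v + fderive E u w.
Proof. by move=> sE su; exact: (derive_lin v w a (local_fun_diff sE (Iu su))). Qed.

Lemma hessP E u a v v' w : smooth_fun (tatlas A) slit E -> slit u ->
  hess E u (a *: v + v') w = a * hess E u v w + hess E u v' w.
Proof. by move=> sE su; exact: (derive_lin v v' a (local_fun_diff2 w sE (Iu su))). Qed.

Lemma hessC E u v w : smooth_fun (tatlas A) slit E -> slit u ->
  hess E u v w = hess E u w v.
Proof. by move=> sE su; exact: (derive_sym v w (@oI u) (Iu su) (CE u 2 sE)). Qed.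

Lemma hess0l E u w : hess E u 0 w = 0.
Proof. exact: derive0. Qed.

Lemma hess0r E u v : smooth_fun (tatlas A) slit E -> slit u -> hess E u v 0 = 0.
Proof. by move=> sE su; rewrite hessC// hess0l. Qed.

Lemma hess_suml E u w m (a : 'I_m -> R) (F : 'I_m -> 'rV[R]_(n + n)) :
  smooth_fun (tatlas A) slit E -> slit u ->
  hess E u (\sum_i a i *: F i) w = \sum_i a i * hess E u (F i) w.
Proof.
move=> sE su; apply: (big_ind2 (fun x y => hess E u x w = y)).
- exact: hess0l.
- by move=> x1 y1 x2 y2 <- <-; rewrite -[x1 in LHS]scale1r (hessP _ _ _ _ sE su) mul1r.
- by move=> i _; rewrite -[a i *: F i]addr0 (hessP _ _ _ _ sE su) hess0l addr0.
Qed.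

Lemma fderive0 E u : fderive E u 0 = 0.
Proof. exact: derive0. Qed.

Lemma d_fderive E X u : d E X u = fderive E u (X u).
Proof. by []. Qed.

(** The first-order terms of the exterior derivative cancel. *)
Lemma Omega_hess L W X u : smooth_fun (tatlas A) slit (energy L) -> slit u ->
  slit_field W -> slit_field X ->
  Omega L W X u = hess (energy L) u (W u) (J X u) - hess (energy L) u (X u) (J W u).
Proof.
move=> sE su sW sX; set c := chart_at (tatlas A) u.
have h1 := ra_at rT u.
have H V Z : slit_field Z -> dfun (tatlas A) (dJ (energy L) Z) V u =
    hess (energy L) u (V u) (J Z u) + fderive (energy L) u (dcoord u (J Z) (V u)).
  move=> sZ; have sJZ := smooth_J rM sZ.
  have dJZ := smooth_field_diff sJZ h1 (ra_dom rT u) su.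
  transitivity ('D_(V u) (fun x => 'D_(local_field (tatlas A) (J Z) c x) (local_fun (energy L) u) x) (c u)).
    apply: near_eq_derive; apply: (near_slit rM su) => x cx.
    exact: (local_d rM (J Z) sE cx).
  apply: (etrans (derive_derive1 (V u) (@oI u) (Iu su) (CE u 2 sE) dJZ)).
  exact: (congr1 (fun w => hess (energy L) u (V u) w + fderive (energy L) u (dcoord u (J Z) (V u)))
    (local_field_at rT (J Z) su)).
have H3 : dJ (energy L) (bracket (tatlas A) W X) u =
    fderive (energy L) u (dcoord u (J X) (W u)) - fderive (energy L) u (dcoord u (J W) (X u)).
  have -> : dJ (energy L) (bracket (tatlas A) W X) u = fderive (energy L) u (J (lie W X) u) by [].
  rewrite (J_lie rM su sW sX) -scaleN1r addrC (fderiveP _ _ _ sE su).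
  by rewrite mulN1r addrC.
have alg (a b k p q r t : R) : a = p + r -> b = q + t -> k = r - t ->
    a - b - k = p - q by move=> -> -> ->; ring.
exact: (alg _ _ _ _ _ _ _ (H W X sX) (H X W sW) H3).
Qed.

Lemma smooth_energy L : smooth_fun (tatlas A) slit L ->
  smooth_fun (tatlas A) slit (energy L).
Proof.
move=> sL k c Ac; have oc := chart_image_open_dom rT Ac.
have := CkM oc (Ck_cst k _ (2^-1 : R^o)) (CkM oc (sL k c Ac) (sL k c Ac)).
by apply: (Ck_ext oc) => x _; rewrite /energy /= expr2.
Qed.

Section Homogeneous.
Variable L : TM -> R.
Hypotheses (sL : smooth_fun (tatlas A) slit L)
  (hL : forall u, slit u -> d L liouville u = L u).
Let sE : smooth_fun (tatlas A) slit (energy L) := smooth_energy sL.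

(** Euler's identity for the 2-homogeneous function [energy L]. *)
Lemma euler u x : slit u -> chart_image (chart_at (tatlas A) u) slit x ->
  'D_(vpart x) (local_fun (energy L) u) x = 2 * local_fun (energy L) u x.
Proof.
move=> su cx; have h1 := ra_at rT u.
have dL := local_fun_diff sL cx.
have hx : 'D_(vpart x) (local_fun L u) x = local_fun L u x.
  have [q [cq sq] qx] := cx.
  have := hL sq; rewrite -(ra_mapK rT h1 cq) qx => HL.
  rewrite -[RHS]HL (local_d rM _ sL cx).
  by rewrite (local_liouville rM h1 cx).
have -> : local_fun (energy L) u = 2^-1 \*: (local_fun L u * local_fun L u).
  by apply/funext => z; rewrite /local_fun /energy /= expr2.
have dL' : derivable (local_fun L u) x (vpart x) by exact: diff_derivable.
rewrite deriveZ; last exact: derivableM.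
rewrite deriveM// hx.
change (2^-1 * (local_fun L u x * local_fun L u x + local_fun L u x * local_fun L u x) =
  2 * (2^-1 * (local_fun L u x * local_fun L u x))).
by field.
Qed.

(** The derivative of Euler's identity along [v]. *)
Lemma euler_hess u v : slit u ->
  hess (energy L) u v (liouville u) + fderive (energy L) u (vpart v) =
  2 * fderive (energy L) u v.
Proof.
move=> su; set c := chart_at (tatlas A) u.
have dv : differentiable (vpart : _ -> 'rV[R]_(n + n)) (c u) by exact: linear_rV_differentiable.
have := derive_derive1 v (@oI u) (Iu su) (CE u 2 sE) dv.
rewrite linear_rV_derive.
have -> : vpart (c u) = liouville u by rewrite /vpart /liouville vec_tchart.
move=> H; apply: (etrans (esym H)).
have d1 : derivable (local_fun (energy L) u) (c u) v.
  by apply: diff_derivable; exact: (local_fun_diff sE (Iu su)).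
apply: (etrans _ (deriveZ 2 d1)).
apply: near_eq_derive; apply: (near_slit rM su) => x cx.
exact: euler.
Qed.

(** The metric is half the vertical Hessian of L^2, and L^2 is twice the energy. *)
Lemma metric_hess u (a b : 'rV[R]_n) : slit u ->
  (a *m metric L u *m b^T) 0 0 = hess (energy L) u (row_mx 0 a) (row_mx 0 b).
Proof.
move=> su; set c := chart_at (tatlas A) u.
pose dy i : 'rV[R]_(n + n) := row_mx 0 (delta_mx 0 i).
have mE i j : metric L u i j = hess (energy L) u (dy i) (dy j).
  set L2 : 'rV[R]_(n + n) -> R^o := fun z => L (chart_inv c z) ^+ 2.
  have -> : metric L u i j = 2^-1 * 'D_(dy i) ('D_(dy j) L2) (c u) by rewrite mxE.
  have E2 : L2 = 2 \*: local_fun (energy L) u.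
    apply/funext => z; rewrite /L2 /local_fun /energy /=.
    by rewrite /GRing.scale /= mulrA mulfV ?mul1r// pnatr_eq0.
  have E3 : 'D_(dy i) ('D_(dy j) L2) (c u) = 2 * hess (energy L) u (dy i) (dy j).
    have d2 : derivable ('D_(dy j) (local_fun (energy L) u)) (c u) (dy i).
      by apply: diff_derivable; exact: (local_fun_diff2 _ sE (Iu su)).
    apply: (etrans _ (deriveZ 2 d2)).
    apply: near_eq_derive; apply: (near_slit rM su) => x cx.
    have d1 : derivable (local_fun (energy L) u) x (dy j).
      by apply: diff_derivable; exact: (local_fun_diff sE cx).
    by rewrite E2; exact: deriveZ.
  by rewrite E3 mulrA mulVf ?mul1r// pnatr_eq0.
have rE (e : 'rV[R]_n) : row_mx 0 e = \sum_i e 0 i *: dy i.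
  apply/rowP => j; rewrite summxE; under eq_bigr do rewrite mxE.
  case: (splitP j) => k jk.
    have -> : j = lshift n k by exact/val_inj.
    by rewrite row_mxEl mxE big1// => i _; rewrite row_mxEl mxE mulr0.
  have -> : j = rshift n k by exact/val_inj.
  rewrite row_mxEr (bigD1 k)//= row_mxEr mxE !eqxx mulr1 big1 ?addr0// => i ik.
  by rewrite row_mxEr mxE eqxx eq_sym (negbTE ik) mulr0.
rewrite (rE a) (hess_suml _ _ _ sE su) mxE.
under [RHS]eq_bigr => i _ do rewrite hessC// rE hess_suml// mulr_sumr.
rewrite [RHS]exchange_big/=; apply: eq_bigr => j _; rewrite !mxE mulr_suml.
apply: eq_bigr => i _; rewrite mE (hessC (dy i) (dy j) sE su) -mulrA.
by congr (_ * _); exact: mulrC.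
Qed.

(** Euler's identity, twice: E = g(y, y) / 2. Thus the metric determines the
    energy, and a conformal relation of metrics passes to the energies. *)
Lemma energy_metric u : slit u ->
  energy L u = 2^-1 * (vec u *m metric L u *m (vec u)^T) 0 0.
Proof.
move=> su.
have e1 : hess (energy L) u (liouville u) (liouville u) =
    (vec u *m metric L u *m (vec u)^T) 0 0.
  exact: (esym (metric_hess (vec u) (vec u) su)).
have e2 : vpart (liouville u) = liouville u :> 'rV[R]_(n + n).
  by rewrite /vpart /liouville row_mxKr.
have e3 : fderive (energy L) u (liouville u) = 2 * energy L u.
  have e4 : vpart (chart_at (tatlas A) u u) = liouville u.
    by rewrite /vpart /liouville vec_tchart.
  have e5 : local_fun (energy L) u (chart_at (tatlas A) u u) = energy L u.
    exact: (congr1 (energy L) (ra_mapK rT (ra_at rT u) (ra_dom rT u))).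
  by have := euler su (Iu su); rewrite e4 e5.
have := euler_hess (liouville u) su; rewrite e1 e2 e3.
move: (_ 0 0) (energy L u) => p q; lra.
Qed.

End Homogeneous.
End Energy.

(** * The conformal change of the canonical spray *)

Section SprayChange.
Context {R : realType} {M : topologicalType} {n : nat} {A : atlas R M n}.
Hypothesis hM : smooth_manifold A.
Local Notation TM := (tbundle A).
Local Notation field := (TM -> 'rV[R]_(n + n)).
Let rM : regular_atlas A setT := regular_manifold hM.
Let rT : regular_atlas (tatlas A) slit := regular_tangent rM.
Implicit Types (X Y Z V W G : field) (u : TM) (v w : 'rV[R]_(n + n)).

Let sE L (hL : finsler L) : smooth_fun (tatlas A) slit (energy L) :=
  smooth_energy rM (finsler_smooth hL).

Lemma jmap_liouville u : jmap (liouville u) = 0 :> 'rV[R]_(n + n).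
Proof. by rewrite /jmap /liouville row_mxKl row_mx0. Qed.

Lemma hess_gt0 L u v : finsler L -> slit u -> jmap v = 0 -> v != 0 ->
  0 < hess (energy L) u v v.
Proof.
move=> hL su v0 vn0.
have E : v = row_mx 0 (rsubmx v) by rewrite -[LHS](vpart_vertical v0).
rewrite E -(metric_hess rM (finsler_smooth hL) _ _ su).
apply: (finsler_posdef hL su); apply: contra vn0 => /eqP r0.
by rewrite E r0 row_mx0.
Qed.

(** Test with [v] itself, which is in the image of [jmap] because it is
    vertical. *)
Lemma hess_nondegenerate L u v : finsler L -> slit u -> jmap v = 0 ->
  (forall w, hess (energy L) u v (jmap w) = 0) -> v = 0.
Proof.
move=> hL su v0 H; apply/eqP; apply: contraT => vn0.
have := hess_gt0 hL su v0 vn0.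
have := H (hlift v); rewrite jmap_hlift (vpart_vertical v0) => ->.
by rewrite ltxx.
Qed.

Let euler_hessL L u v (hL : finsler L) (su : slit u) :
  hess (energy L) u v (liouville u) + fderive (energy L) u (vpart v) =
  2 * fderive (energy L) u v :=
  euler_hess rM (finsler_smooth hL) (@finsler_homogeneous _ _ _ _ _ hL) v su.

Lemma spray_equation L G u w : finsler L -> canonical_spray L G -> slit u ->
  hess (energy L) u (G u) (jmap w) - hess (energy L) u w (J G u) =
  - fderive (energy L) u w.
Proof.
move=> hL [sG HG] su; have [X sX Xu] := slit_field_through hM w su.
have := HG X sX u su; rewrite (Omega_hess rM (sE hL) su sG sX) d_fderive Xu.
by rewrite (_ : J X u = jmap w)// -Xu.
Qed.

(** On vertical test vectors the equation of the canonical spray determines its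
    horizontal part. *)
Lemma canonical_spray_spray L G : finsler L -> canonical_spray L G -> spray G.
Proof.
move=> hL cG u su; apply/eqP; rewrite -subr_eq0; apply/eqP.
have JG0 : jmap (J G u) = 0 by exact: jmapK.
apply: (hess_nondegenerate hL su).
  by rewrite linearB /= jmap_liouville JG0 subrr.
move=> w.
have e1 := spray_equation (jmap w) hL cG su.
rewrite jmapK (hess0r rM (G u) (sE hL) su) in e1.
have e2 := euler_hessL (jmap w) hL su; rewrite vpart_jmap in e2.
have -> : J G u - liouville u = (-1) *: liouville u + J G u by rewrite scaleN1r addrC.
rewrite (hessP rM (-1) (liouville u) (J G u) (jmap w) (sE hL) su).
rewrite (hessC rM (liouville u) (jmap w) (sE hL) su).
rewrite (hessC rM (J G u) (jmap w) (sE hL) su).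
move: e1 e2; move: (hess _ _ _ _) (hess _ _ _ _) (fderive _ _ _) => p q r; lra.
Qed.

(** What remains of the equation once the horizontal part is known, simplified
    by Euler's identity. *)
Lemma spray_hess L G u w : finsler L -> canonical_spray L G -> slit u ->
  hess (energy L) u (G u) (jmap w) =
  fderive (energy L) u w - fderive (energy L) u (vpart w).
Proof.
move=> hL cG su; have := spray_equation w hL cG su.
rewrite (canonical_spray_spray hL cG su).
have := euler_hessL w hL su.
move: (hess _ _ _ _) (hess _ _ _ _) (fderive _ _ _) (fderive _ _ _) => p q r t; lra.
Qed.

(** The vertical vector [Z u] is J applied to a field through [hlift (Z u)], so
    the metric on vertical vectors can be evaluated at it. *)
Lemma vertical_gradient_hess L gb s Z u w : finsler L -> vertical_metric L gb ->
  vertical_gradient gb s Z -> slit u ->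
  fderive s u w = hess (energy L) u (Z u) (jmap w).
Proof.
move=> hL hgb [sZ vZ gZ] su; have [Y sY Yu] := slit_field_through hM w su.
have [N sN Nu] := slit_field_through hM (hlift (Z u)) su.
have Z0 : jmap (Z u) = 0 by exact: ((verticalP Z).1 vZ).
have NZ : J N u = Z u by rewrite (_ : J N u = jmap (N u))// Nu jmap_hlift vpart_vertical.
have YJ : J Y u = jmap w by rewrite -Yu.
have := gZ Y sY u su; rewrite -NZ (hgb N Y sN sY u su) d_fderive Yu => ->.
rewrite (Omega_hess rM (sE hL) su (smooth_J rM sN) sY) YJ.
have -> : J (J N) u = 0 by exact: jmapK.
by rewrite (hess0r rM (Y u) (sE hL) su) subr0.
Qed.

Let spray_algebra (a e hC hg hD p q hw hv sw j : R) : p = hD + q -> q = hw - hv ->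
    p + 2 * a * j = hw + 2 * e * sw - (hv + 2 * e * 0) -> sw = hg ->
    hC + j = 2 * j -> 2 * a * hC + (- (2 * e) * hg + hD) = 0.
Proof.
move=> q0 q1 q2 <- q4.
have -> : hD = 2 * e * sw - 2 * a * j by lra.
have -> : hC = j by lra.
ring.
Qed.

Section Conformal.
Variables (L Lt : TM -> R) (sigma : M -> R).
Hypotheses (hL : finsler L) (hLt : finsler Lt) (ss : smooth_fun A setT sigma)
  (hconf : conformal L Lt sigma).
Local Notation s := (pullback sigma : TM -> R).
Let sps : smooth_fun (tatlas A) slit s := smooth_pullback rM ss.

Lemma conformal_energy u : slit u -> energy Lt u = expR (2 * s u) * energy L u.
Proof.
move=> su.
have e1 := energy_metric rM (finsler_smooth hLt) (@finsler_homogeneous _ _ _ _ _ hLt) su.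
have e2 := energy_metric rM (finsler_smooth hL) (@finsler_homogeneous _ _ _ _ _ hL) su.
rewrite e1 e2 (hconf su) -scalemxAr -scalemxAl [in LHS]mxE.
by rewrite mulrCA.
Qed.

Let f u (x : 'rV[R]_(n + n)) : R^o := expR (2 * local_fun s u x).

Let Iu u : slit u -> chart_image (chart_at (tatlas A) u) slit (chart_at (tatlas A) u u).
Proof. by move=> su; exact: (chart_image_mem (ra_dom rT u) su). Qed.

Let local_diff (E : TM -> R) u x : smooth_fun (tatlas A) slit E ->
  chart_image (chart_at (tatlas A) u) slit x -> differentiable (local_fun E u) x.
Proof. by move=> sF; have [+ _] := sF 1%N _ (ra_at rT u); apply. Qed.

Let local_diff2 (E : TM -> R) u x v : smooth_fun (tatlas A) slit E ->
  chart_image (chart_at (tatlas A) u) slit x -> differentiable ('D_v (local_fun E u)) x.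
Proof. by move=> sF; have [_ H] := sF 2%N _ (ra_at rT u); have [+ _] := H v; apply. Qed.

Let df u x v : chart_image (chart_at (tatlas A) u) slit x ->
  differentiable (f u) x /\ 'D_v (f u) x = f u x * (2 * 'D_v (local_fun s u) x).
Proof.
move=> cx; have ds := local_diff sps cx.
have d2 : differentiable (2 \*: local_fun s u) x by exact: differentiableZ.
have de (y : R^o) : differentiable (expR : R^o -> R^o) y.
  by have [+ _] := is_derive_expR y; move/derivable1_diffP.
have fE : f u = (expR : R^o -> R^o) \o (2 \*: local_fun s u) by [].
have d2v : derivable (local_fun s u) x v by exact: diff_derivable.
split; first by rewrite fE; exact: (differentiable_comp d2 (de _)).
rewrite fE; apply: (etrans (derive_comp v d2 (de _))).
have -> : 'D_v (2 \*: local_fun s u) x = (2 * 'D_v (local_fun s u) x) *: (1 : R^o).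
  by apply: (etrans (deriveZ 2 d2v)); exact: (esym (mulr1 _)).
apply: (etrans (derive_dirZ _ _ (de _))).
have [_ E] := is_derive_expR ((2 \*: local_fun s u) x).
by rewrite E; exact: mulrC.
Qed.

Let local_Et u x : chart_image (chart_at (tatlas A) u) slit x ->
  local_fun (energy Lt) u x = (f u * local_fun (energy L) u) x.
Proof.
move=> [q [cq sq] <-]; have K := ra_mapK rT (ra_at rT u) cq.
apply: (etrans (congr1 (energy Lt) K)); apply: (etrans (conformal_energy sq)).
by rewrite -{1 2}K.
Qed.

Let derive_Et u x v : chart_image (chart_at (tatlas A) u) slit x ->
  'D_v (local_fun (energy Lt) u) x = f u x * 'D_v (local_fun (energy L) u) x +
   local_fun (energy L) u x * (f u x * (2 * 'D_v (local_fun s u) x)).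
Proof.
move=> cx; have [d1 e1] := df v cx; have d2 := local_diff (sE hL) cx.
rewrite -e1.
transitivity ('D_v (f u * local_fun (energy L) u) x).
  apply: near_eq_derive; apply: (open_near (chart_image_open_dom rT (ra_at rT u)) cx) => y cy.
  exact: local_Et.
have h1 : derivable (f u) x v by exact: diff_derivable.
have h2 : derivable (local_fun (energy L) u) x v by exact: diff_derivable.
exact: (deriveM h1 h2).
Qed.

Let local_at (E : TM -> R) u : local_fun E u (chart_at (tatlas A) u u) = E u.
Proof. exact: (congr1 E (ra_mapK rT (ra_at rT u) (ra_dom rT u))). Qed.

Let fu u : f u (chart_at (tatlas A) u u) = expR (2 * s u).
Proof. by rewrite /f local_at. Qed.

(** The product rule for the energy exp(2 sigma) E. *)
Lemma conformal_fderive u v : slit u -> fderive (energy Lt) u v =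
  expR (2 * s u) * (fderive (energy L) u v + 2 * energy L u * fderive s u v).
Proof.
move=> su; apply: (etrans (derive_Et v (Iu su))); rewrite fu local_at /fderive.
move: ('D_v _ _) ('D_v _ _) => a b; ring.
Qed.

(** As sigma is constant along the vertical vector [jmap w], the inner derivative
    does not see the conformal factor. *)
Lemma conformal_hess u v w : slit u -> hess (energy Lt) u v (jmap w) =
  expR (2 * s u) * (hess (energy L) u v (jmap w) +
                    2 * fderive s u v * fderive (energy L) u (jmap w)).
Proof.
move=> su; have [d1 e1] := df v (Iu su).
have d2 := local_diff2 (jmap w) (sE hL) (Iu su).
transitivity ('D_v (f u * 'D_(jmap w) (local_fun (energy L) u)) (chart_at (tatlas A) u u)).
  apply: near_eq_derive; apply: (near_slit rM su) => x cx.
  apply: (etrans (derive_Et (jmap w) cx)).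
  have s0 : 'D_(jmap w) (local_fun s u) x = 0.
    exact: (local_pullback_vertical rM ss cx (jmapK w)).
  by rewrite s0 !mulr0 addr0.
have h1 : derivable (f u) (chart_at (tatlas A) u u) v by exact: diff_derivable.
have h2 : derivable ('D_(jmap w) (local_fun (energy L) u)) (chart_at (tatlas A) u u) v.
  exact: diff_derivable.
apply: (etrans (deriveM h1 h2)); rewrite e1 fu /hess /fderive /GRing.scale /=.
move: ('D_v _ _) ('D_v _ _) ('D_(jmap w) _ _) => a b c; ring.
Qed.

Variables (G Gt : field) (gb : TM -> 'rV[R]_(n + n) -> 'rV[R]_(n + n) -> R) (grad : field).
Hypotheses (hG : canonical_spray L G) (hGt : canonical_spray Lt Gt)
  (hgb : vertical_metric L gb) (hgrad : vertical_gradient gb s grad).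

(** Both sides satisfy the equation of the canonical spray of the second
    metric, which is nondegenerate on vertical vectors. *)
Lemma conformal_spray u : slit u ->
  Gt u = G u - (2 * d s G u) *: liouville u + (2 * energy L u) *: grad u.
Proof.
move=> su; have sp := canonical_spray_spray hL hG; have spt := canonical_spray_spray hLt hGt.
have g0 : jmap (grad u) = 0 by have [_ vg _] := hgrad; exact: ((verticalP grad).1 vg).
have GG : jmap (Gt u - G u) = 0.
  rewrite linearB; apply/eqP; rewrite subr_eq0; apply/eqP.
  exact: (etrans (spt u su) (esym (sp u su))).
have sGG : fderive s u (Gt u) = d s G u.
  have s0 : fderive s u (Gt u - G u) = 0 by exact: (local_pullback_vertical rM ss (Iu su) GG).
  have := fderiveP rM 1 (Gt u - G u) (G u) sps su.
  by rewrite scale1r subrK s0 mulr0 add0r.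
pose D : 'rV[R]_(n + n) := (2 * d s G u) *: liouville u +
  ((- (2 * energy L u)) *: grad u + (Gt u - G u)).
suff D0 : D = 0.
  have -> : Gt u = D + (G u - (2 * d s G u) *: liouville u + (2 * energy L u) *: grad u).
    rewrite /D; move: (_ *: liouville u) (grad u) (2 * energy L u) (Gt u) (G u) => a b e x y.
    rewrite scaleNr; move: (e *: b) => c.
    by apply/rowP => i; rewrite !mxE; ring.
  by rewrite D0 add0r.
apply: (hess_nondegenerate hL su).
  by rewrite /D linearP /= jmap_liouville scaler0 add0r linearP /= g0 scaler0 add0r.
move=> w.
rewrite /D (hessP rM _ _ _ _ (sE hL) su) (hessP rM _ _ _ _ (sE hL) su).
have e0 := hessP rM 1 (Gt u - G u) (G u) (jmap w) (sE hL) su.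
rewrite scale1r subrK mul1r in e0.
have e1 := spray_hess w hL hG su.
have e2 := spray_hess w hLt hGt su.
have e3 := vertical_gradient_hess w hL hgb hgrad su.
have e4 := euler_hessL (jmap w) hL su.
rewrite vpart_jmap (hessC rM (jmap w) (liouville u) (sE hL) su) in e4.
rewrite (conformal_hess _ _ su) (conformal_fderive _ su) (conformal_fderive _ su) -mulrBr in e2.
have {}e2 := mulfI (lt0r_neq0 (expR_gt0 _)) e2.
have e5 : fderive s u (vpart w) = 0.
  exact: (local_pullback_vertical rM ss (Iu su) (jmap_vpart w)).
rewrite sGG e5 in e2.
exact: (spray_algebra e0 e1 e2 e3 e4).
Qed.
End Conformal.
End SprayChange.

(** * The Barthel connection and its curvature *)

Section FieldAlgebra.
Context {R : realType} {M : Type} {n : nat} {A : atlas R M n}.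
Hypothesis rM : regular_atlas A setT.
Local Notation TM := (tbundle A).
Local Notation field := (TM -> 'rV[R]_(n + n)).
Let rT : regular_atlas (tatlas A) slit := regular_tangent rM.
Implicit Types (X Y Z V W G : field) (u : TM) (f : TM -> R).

Let sub_addACA (a b c e : 'rV[R]_(n + n)) : (a + b) - (c + e) = (a - c) + (b - e).
Proof. by rewrite opprD addrACA. Qed.

Lemma smooth_cst (a : R) : smooth_fun (tatlas A) slit (fun=> a).
Proof. by move=> k c Ac; exact: Ck_cst. Qed.

Lemma slit_field0 : slit_field (0 : field).
Proof. by move=> c Ac k; apply: (Ck_ext (chart_image_open_dom rT Ac) _ (Ck_cst k _ 0)) => x _; exact: (esym (derive0 _ _)). Qed.

Lemma slit_scale f X : smooth_fun (tatlas A) slit f -> slit_field X -> slit_field (scale f X).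
Proof.
move=> sf sX; apply: (smooth_fieldP rT sf sX slit_field0) => u su.
by rewrite /scale addr0.
Qed.

Lemma slitZ (a : R) X : slit_field X -> slit_field (a *: X).
Proof. exact: (slit_scale (smooth_cst a)). Qed.

Lemma slitD X Y : slit_field X -> slit_field Y -> slit_field (X + Y).
Proof.
move=> sX sY; apply: (smooth_fieldP rT (smooth_cst 1) sX sY) => u su.
by rewrite scale1r.
Qed.

Lemma slitN X : slit_field X -> slit_field (- X).
Proof. by move=> sX; rewrite -scaleN1r; exact: slitZ. Qed.

Lemma slitB X Y : slit_field X -> slit_field Y -> slit_field (X - Y).
Proof. by move=> sX sY; exact: (slitD sX (slitN sY)). Qed.

Lemma slit_lie X Y : slit_field X -> slit_field Y -> slit_field (lie X Y).
Proof. exact: (smooth_bracket rT). Qed.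

Lemma lieC X Y u : lie X Y u = - lie Y X u.
Proof. exact: bracketC. Qed.

Lemma lie_eq X X' Y Y' u : slit u -> (forall u, slit u -> X u = X' u) ->
  (forall u, slit u -> Y u = Y' u) -> lie X Y u = lie X' Y' u.
Proof. by move=> su EX EY; exact: (bracket_eq rT EX EY su). Qed.

Lemma d_cst (a : R) X u : d (fun=> a : R) X u = 0.
Proof. exact: (derive_cst (a : R^o)). Qed.

Lemma lie0 X u : slit u -> lie X (0 : field) u = 0.
Proof.
move=> su; rewrite lie_dcoord (dcoord0 rM)// sub0r.
by rewrite /dcoord derive0 oppr0.
Qed.

Lemma lieDr X Y Z u : slit u -> slit_field X -> slit_field Y -> slit_field Z ->
  lie X (Y + Z) u = lie X Y u + lie X Z u.
Proof.
move=> su sX sY sZ.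
have E q : slit q -> (Y + Z) q = 1 *: Y q + Z q by rewrite scale1r.
apply: (etrans (bracket_leibniz rT (smooth_cst 1) sX sY sZ E su)).
by rewrite scale1r -/(d _ _) d_cst scale0r addr0.
Qed.

Lemma lieDl X Y Z u : slit u -> slit_field X -> slit_field Y -> slit_field Z ->
  lie (Y + Z) X u = lie Y X u + lie Z X u.
Proof. by move=> *; rewrite lieC lieDr// (lieC Y) (lieC Z) opprD. Qed.

Lemma lie_scale X f Y u : slit u -> smooth_fun (tatlas A) slit f ->
  slit_field X -> slit_field Y ->
  lie X (scale f Y) u = f u *: lie X Y u + d f X u *: Y u.
Proof.
move=> su sf sX sY.
have E q : slit q -> scale f Y q = f q *: Y q + (0 : field) q by rewrite addr0.
apply: (etrans (bracket_leibniz rT sf sX sY slit_field0 E su)).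
exact: (etrans (congr1 (+%R _) (lie0 X su)) (addr0 _)).
Qed.

(** Fields carry no information off the slit bundle; [sa_eq] lets identities that
    hold on it be used inside such an operator. *)
Record slit_additive (K : field -> field) : Prop := SlitAdditive {
  sa_slit : forall X, slit_field X -> slit_field (K X);
  sa_eq : forall X Y, (forall u, slit u -> X u = Y u) ->
    forall u, slit u -> K X u = K Y u;
  sa_D : forall X Y, slit_field X -> slit_field Y ->
    forall u, slit u -> K (X + Y) u = K X u + K Y u }.

Lemma sa_B K X Y u : slit_additive K -> slit_field X -> slit_field Y ->
  slit u -> K (X - Y) u = K X u - K Y u.
Proof.
move=> aK sX sY su; apply/eqP; rewrite eq_sym subr_eq; apply/eqP.
by rewrite -(sa_D aK (slitB sX sY) sY su) subrK.
Qed.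

Lemma slit_additive_J : slit_additive J.
Proof.
split=> [X|X Y E u su|X Y _ _ u _]; first exact: smooth_J.
  by rewrite /J E.
exact: (linearD jmap).
Qed.

Lemma slit_additive_add K N : slit_additive K -> slit_additive N ->
  slit_additive (fun X => K X + N X).
Proof.
move=> aK aN; split=> [X sX|X Y E u su|X Y sX sY u su].
- exact: (slitD (sa_slit aK sX) (sa_slit aN sX)).
- by rewrite !fctE (sa_eq aK E su) (sa_eq aN E su).
- by rewrite !fctE (sa_D aK sX sY su) (sa_D aN sX sY su) addrACA.
Qed.

Lemma slit_additive_scale f K : smooth_fun (tatlas A) slit f -> slit_additive K ->
  slit_additive (fun X => scale f (K X)).
Proof.
move=> sf aK; split=> [X sX|X Y E u su|X Y sX sY u su].
- exact: (slit_scale sf (sa_slit aK sX)).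
- by rewrite /scale (sa_eq aK E su).
- by rewrite /scale (sa_D aK sX sY su) scalerDr.
Qed.

Lemma slit_additive_id : slit_additive id.
Proof. by split=> // X Y E u /E. Qed.

Lemma slit_additive_bracket Z : slit_field Z ->
  slit_additive (fn_bracket10 (tatlas A) J Z).
Proof.
move=> sZ; have aJ := slit_additive_J.
split=> [X sX|X Y E u su|X Y sX sY u su].
- exact: (slitB (slit_lie (smooth_J rM sX) sZ) (smooth_J rM (slit_lie sX sZ))).
- have e1 : lie (J X) Z u = lie (J Y) Z u.
    by apply: (lie_eq su _ (fun _ _ => erefl)) => q sq; exact: (sa_eq aJ E sq).
  have e2 : J (lie X Z) u = J (lie Y Z) u.
    by apply: (sa_eq aJ _ su) => q sq; exact: (lie_eq sq E (fun _ _ => erefl)).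
  exact: (f_equal2 (fun a b => a - b) e1 e2).
- have sJX := smooth_J rM sX; have sJY := smooth_J rM sY.
  have e1 : lie (J (X + Y)) Z u = lie (J X) Z u + lie (J Y) Z u.
    rewrite -(lieDl su sZ sJX sJY); apply: (lie_eq su _ (fun _ _ => erefl)) => q sq.
    exact: (sa_D aJ sX sY sq).
  have e2 : J (lie (X + Y) Z) u = J (lie X Z) u + J (lie Y Z) u.
    rewrite -(sa_D aJ (slit_lie sX sZ) (slit_lie sY sZ) su).
    by apply: (sa_eq aJ _ su) => q sq; exact: (lieDl sq sZ sX sY).
  exact: (etrans (f_equal2 (fun a b => a - b) e1 e2) (sub_addACA _ _ _ _)).
Qed.

Lemma slit_additive_d f Z : smooth_fun (tatlas A) slit f -> slit_field Z ->
  slit_additive (fun X => scale (d f X) Z).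
Proof.
move=> sf sZ; split=> [X sX|X Y E u su|X Y sX sY u su].
- exact: (slit_scale (smooth_dfun rT sf sX) sZ).
- by rewrite /scale !d_fderive E.
- have e := fderiveP rM 1 (X u) (Y u) sf su; rewrite scale1r mul1r in e.
  by rewrite /scale -scalerDl -e.
Qed.

Lemma slit_additive_dJ f Z : smooth_fun (tatlas A) slit f -> slit_field Z ->
  slit_additive (fun X => scale (dJ f X) Z).
Proof.
move=> sf sZ; have aJ := slit_additive_J; have ad := slit_additive_d sf sZ.
split=> [X sX|X Y E u su|X Y sX sY u su].
- exact: (sa_slit ad (smooth_J rM sX)).
- by apply: (sa_eq ad _ su) => q sq; exact: (sa_eq aJ E sq).
- rewrite -(sa_D ad (smooth_J rM sX) (smooth_J rM sY) su).
  by apply: (sa_eq ad _ su) => q sq; exact: (sa_D aJ sX sY sq).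
Qed.

Lemma fn_bracketD Y Z X u : slit u -> slit_field X -> slit_field Y -> slit_field Z ->
  fn_bracket10 (tatlas A) J (Y + Z) X u =
  fn_bracket10 (tatlas A) J Y X u + fn_bracket10 (tatlas A) J Z X u.
Proof.
move=> su sX sY sZ; have aJ := slit_additive_J; have sJX := smooth_J rM sX.
have e : J (lie X (Y + Z)) u = J (lie X Y) u + J (lie X Z) u.
  rewrite -(sa_D aJ (slit_lie sX sY) (slit_lie sX sZ) su).
  by apply: (sa_eq aJ _ su) => q sq; exact: (lieDr sq sX sY sZ).
have eJ := lieDr su sJX sY sZ.
exact: (etrans (f_equal2 (fun a b => a - b) eJ e) (sub_addACA _ _ _ _)).
Qed.

(** The general rule has the further term -(X f) J Z, which vanishes for
    vertical [Z]. *)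
Lemma fn_bracket_scale f Z X u : slit u -> smooth_fun (tatlas A) slit f ->
  slit_field X -> slit_field Z -> vertical Z ->
  fn_bracket10 (tatlas A) J (scale f Z) X u =
  f u *: fn_bracket10 (tatlas A) J Z X u + dJ f X u *: Z u.
Proof.
move=> su sf sX sZ /verticalP vZ; have aJ := slit_additive_J; have sJX := smooth_J rM sX.
have e : J (lie X (scale f Z)) u = f u *: J (lie X Z) u.
  have Z0 : jmap (Z u) = 0 by exact: vZ.
  apply: (etrans (congr1 jmap (lie_scale su sf sX sZ))).
  have alg (r t : R) (a b : 'rV[R]_(n + n)) : jmap b = 0 ->
      jmap (r *: a + t *: b) = r *: jmap a.
    by move=> b0; rewrite linearD !linearZ /= b0 scaler0 addr0.
  exact: alg Z0.
have eJ := lie_scale su sf sJX sZ.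
have alg (r t : R) (a b c : 'rV[R]_(n + n)) :
    (r *: a + t *: c) - r *: b = r *: (a - b) + t *: c by rewrite scalerBr addrAC.
exact: (etrans (f_equal2 (fun a b => a - b) eJ e) (alg _ _ _ _ _)).
Qed.

Lemma fn_bracket_eq Z Z' X u : slit u -> (forall u, slit u -> Z u = Z' u) ->
  fn_bracket10 (tatlas A) J Z X u = fn_bracket10 (tatlas A) J Z' X u.
Proof.
move=> su E.
have e1 : lie (J X) Z u = lie (J X) Z' u by exact: (lie_eq su (fun _ _ => erefl) E).
have e2 : J (lie X Z) u = J (lie X Z') u.
  by apply: (sa_eq slit_additive_J _ su) => q sq; exact: (lie_eq sq (fun _ _ => erefl) E).
exact: (f_equal2 (fun a b => a - b) e1 e2).
Qed.

Section Barthel.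
Variable G : field.
Hypotheses (sG : slit_field G) (hG : spray G).

Lemma slit_additive_hproj : slit_additive (hproj G).
Proof.
exact: (slit_additive_scale (smooth_cst 2^-1)
  (slit_additive_add slit_additive_id (slit_additive_bracket sG))).
Qed.

(** On vertical fields the Barthel connection is minus the identity, by
    [J_lie_spray]. *)
Lemma hproj_vertical V u : slit u -> slit_field V -> vertical V -> hproj G V u = 0.
Proof.
move=> su sV vV.
have e0 : lie G (J V) u = 0.
  apply: (etrans _ (lie0 G su)).
  exact: (lie_eq su (fun _ _ => erefl) ((verticalP V).1 vV)).
have e1 : lie (J V) G u = 0 by apply: (etrans (lieC _ _ _)); rewrite e0 oppr0.
have e2 := J_lie_spray rM su sV sG vV hG.
have alg (x a b : 'rV[R]_(n + n)) : a = 0 -> b = x -> 2^-1 *: (x + (a - b)) = 0.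
  by move=> -> ->; rewrite sub0r subrr scaler0.
exact: alg e1 e2.
Qed.

(** J h = J, again by [J_lie_spray]. *)
Lemma vertical_subr_hproj X : slit_field X -> vertical (X - hproj G X).
Proof.
move=> sX; apply/verticalP => u su.
apply: (etrans (sa_B slit_additive_J sX (sa_slit slit_additive_hproj sX) su)).
have J0 : jmap (J (lie X G) u) = 0 by exact: jmapK.
have J1 : jmap (lie (J X) G u) = J X u.
  exact: (J_lie_spray rM su (smooth_J rM sX) sG (@vertical_J _ _ _ _ X) hG).
have alg (x a b : 'rV[R]_(n + n)) : jmap a = jmap x -> jmap b = 0 ->
    jmap x - jmap (2^-1 *: (x + (a - b))) = 0.
  move=> ea eb; rewrite linearZ linearD linearB /= ea eb subr0.
  by move: (jmap x) => y; apply/rowP => i; rewrite !mxE; field.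
exact: alg J1 J0.
Qed.

Lemma vprojE X u : vproj G X u = X u - hproj G X u.
Proof.
have -> : vproj G X u = 2^-1 *: (X u - barthel G X u) by [].
have -> : hproj G X u = 2^-1 *: (X u + barthel G X u) by [].
move: (X u) (barthel G X u) => x y; apply/rowP => i; rewrite !mxE.
by field.
Qed.

(** X - h X is vertical and h kills vertical fields. *)
Lemma hproj_hproj X u : slit u -> slit_field X -> hproj G (hproj G X) u = hproj G X u.
Proof.
move=> su sX; have ah := slit_additive_hproj; have sh := sa_slit ah sX.
have := hproj_vertical su (slitB sX sh) (vertical_subr_hproj sX).
by rewrite (sa_B ah sX sh su) => /eqP; rewrite subr_eq0 => /eqP ->.
Qed.

(** The curvature is the vertical part of -[hX, hY], since the vertical
    distribution is involutive. *)
Lemma curvatureE X Y u : slit u -> slit_field X -> slit_field Y ->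
  curvature G X Y u =
  hproj G (lie (hproj G X) (hproj G Y)) u - lie (hproj G X) (hproj G Y) u.
Proof.
move=> su sX sY; set h := hproj G; have ah := slit_additive_hproj.
have shX : slit_field (h X) := sa_slit ah sX.
have shY : slit_field (h Y) := sa_slit ah sY.
have sXY := slit_lie sX sY; have shXY := slit_lie shX sY.
have sXhY := slit_lie sX shY; have sPP := slit_lie shX shY.
have svX := slitB sX shX; have svY := slitB sY shY.
have E : h (lie (X - h X) (Y - h Y)) u = 0.
  apply: (hproj_vertical su (slit_lie svX svY)).
  exact: (vertical_lie rM svX svY (vertical_subr_hproj sX) (vertical_subr_hproj sY)).
have lieBr P q : slit q -> slit_field P -> lie P (Y - h Y) q = lie P Y q - lie P (h Y) q.
  by move=> sq sP; apply/eqP; rewrite eq_sym subr_eq -(lieDr sq sP svY shY) subrK.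
have E1 : h (lie (X - h X) (Y - h Y)) u =
    h ((lie X Y - lie X (h Y)) - (lie (h X) Y - lie (h X) (h Y))) u.
  apply: (sa_eq ah _ su) => q sq.
  transitivity (lie X (Y - h Y) q - lie (h X) (Y - h Y) q).
    by apply/eqP; rewrite eq_sym subr_eq -(lieDl sq svY svX shX) subrK.
  by rewrite (lieBr _ _ sq sX) (lieBr _ _ sq shX).
have S1 := sa_B ah (slitB sXY sXhY) (slitB shXY sPP) su.
have S2 := f_equal2 (fun a b => a - b) (sa_B ah sXY sXhY su) (sa_B ah shXY sPP su).
have {}E := etrans (esym (etrans (etrans E1 S1) S2)) E.
have hh := hproj_hproj su sXY.
have alg (a b c e k : 'rV[R]_(n + n)) : (a - b) - (c - e) = 0 ->
    - (2^-1 *: (k + k + a + a - c - b - c - b)) = e - k.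
  move=> H; have -> : e = c + b - a.
    by apply/eqP; rewrite -subr_eq0 -[X in _ == X]H; apply/eqP/rowP => i; rewrite !mxE; ring.
  by apply/rowP => i; rewrite !mxE; field.
apply: (etrans _ (alg _ _ _ _ _ E)).
exact: (congr1 (fun a => - (2^-1 *: (lie (h X) (h Y) u + lie (h X) (h Y) u
    + a + a - h (lie (h X) Y) u - h (lie X (h Y)) u
    - h (lie (h X) Y) u - h (lie X (h Y)) u))) hh).
Qed.

End Barthel.
End FieldAlgebra.

(** * The conformal change of the Barthel connection *)

Section ConformalForm.
Context {R : realType} {M : topologicalType} {n : nat} {A : atlas R M n}.
Local Notation TM := (tbundle A).
Local Notation field := (TM -> 'rV[R]_(n + n)).
Variables (hM : smooth_manifold A) (L : TM -> R) (hL : finsler L) (sigma : M -> R)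
  (ss : smooth_fun A setT sigma) (G grad : field).
Hypotheses (sG : slit_field G) (hG : spray G) (sgrad : slit_field grad)
  (vgrad : vertical grad).
Let rM : regular_atlas A setT := regular_manifold hM.
Let rT : regular_atlas (tatlas A) slit := regular_tangent rM.
Let sE : smooth_fun (tatlas A) slit (energy L) := smooth_energy rM (finsler_smooth hL).
Let sp : smooth_fun (tatlas A) slit (pullback sigma) := smooth_pullback rM ss.
Let s1 : smooth_fun (tatlas A) slit (d (pullback sigma) G) := smooth_dfun rT sp sG.
Let vC : vertical (@liouville R M n A).
Proof. by apply/verticalP => u su; exact: jmap_liouville. Qed.

Local Notation LL := (conformal_form L G (pullback sigma) grad).
Local Notation B := (fn_bracket10 (tatlas A) J grad).

Lemma conformal_formE X u : LL X u =
  d (pullback sigma) X u *: liouville u + d (pullback sigma) G u *: J X u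
  - dJ (energy L) X u *: grad u - energy L u *: B X u.
Proof. by []. Qed.

Lemma slit_additive_opp (K : field -> field) : slit_additive K ->
  slit_additive (fun X => - K X).
Proof.
move=> aK; split=> [X sX|X Y E u su|X Y sX sY u su].
- exact: (slitN rM (sa_slit aK sX)).
- exact: (congr1 -%R (sa_eq aK E su)).
- exact: (etrans (congr1 -%R (sa_D aK sX sY su)) (opprD _ _)).
Qed.

Lemma slit_additive_conformal_form : slit_additive LL.
Proof.
have a1 := slit_additive_d rM sp (smooth_liouville rM).
have a2 := slit_additive_scale rM s1 (slit_additive_J rM).
have a3 := slit_additive_opp (slit_additive_dJ rM sE sgrad).
have a4 := slit_additive_opp (slit_additive_scale rM sE (slit_additive_bracket rM sgrad)).
exact: (slit_additive_add rM (slit_additive_add rM (slit_additive_add rM a1 a2) a3) a4).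
Qed.

(** J maps to vertical fields, which are closed under brackets. *)
Lemma vertical_bracket_grad X : slit_field X -> vertical (B X).
Proof.
move=> sX; apply/verticalP => u su.
have J1 := (verticalP _).1 (vertical_lie rM (smooth_J rM sX) sgrad (@vertical_J _ _ _ _ X) vgrad) u su.
have J2 : jmap (J (lie X grad) u) = 0 by exact: jmapK.
have alg (a b : 'rV[R]_(n + n)) : jmap a = 0 -> jmap b = 0 -> jmap (a - b) = 0.
  by move=> ea eb; rewrite linearB /= ea eb subrr.
exact: alg J1 J2.
Qed.

Lemma vertical_conformal_form X : slit_field X -> vertical (LL X).
Proof.
move=> sX; apply/verticalP => u su.
have JB : jmap (B X u) = 0 by exact: (verticalP _).1 (vertical_bracket_grad sX) u su.
have JJ : jmap (J X u) = 0 by exact: jmapK.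
have Jg : jmap (grad u) = 0 by exact: (verticalP _).1 vgrad u su.
have alg (p q r t : R) (a b c e : 'rV[R]_(n + n)) : jmap a = 0 -> jmap b = 0 ->
    jmap c = 0 -> jmap e = 0 -> jmap (p *: a + q *: b - r *: c - t *: e) = 0.
  move=> ea eb ec ee; rewrite !linearB linearD.
  by rewrite !linearZ /= ea eb ec ee !(oppr0, scaler0, addr0).
exact: alg (jmap_liouville u) JJ Jg JB.
Qed.

Lemma conformal_form_vertical V u : slit u -> slit_field V -> vertical V -> LL V u = 0.
Proof.
move=> su sV vV.
have JV : J V u = 0 by exact: (verticalP _).1 vV u su.
have d0 : d (pullback sigma) V u = 0 by exact: (d_vertical_pullback rM ss su vV).
have E0 : dJ (energy L) V u = 0.
  by rewrite /dJ d_fderive JV; exact: fderive0.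
have B0 : B V u = 0.
  have e1 : lie (J V) grad u = 0.
    apply: (etrans (lieC _ _ _)); apply/eqP; rewrite oppr_eq0; apply/eqP.
    apply: (etrans _ (lie0 rM grad su)).
    exact: (lie_eq rM su (fun _ _ => erefl) ((verticalP V).1 vV)).
  have e2 := (verticalP _).1 (vertical_lie rM sV sgrad vV vgrad) u su.
  exact: (etrans (f_equal2 (fun a b => a - b) e1 e2) (subrr _)).
rewrite conformal_formE JV d0 E0 B0.
by rewrite !scaler0 !scale0r !subr0 addr0.
Qed.

(** The rule [J, f Z] = f [J, Z] + d_J f (x) Z for vertical Z, applied to the two
    terms -2 sigma_1 C and 2 E grad by which the sprays differ. The summand
    d sigma (x) C comes from d_J sigma_1 = d sigma, the summand sigma_1 J from
    [J, C] = J. *)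
Lemma barthel_conformal Gt X u : slit u -> slit_field X ->
  (forall u, slit u ->
    Gt u = G u - (2 * d (pullback sigma) G u) *: liouville u + (2 * energy L u) *: grad u) ->
  barthel Gt X u = barthel G X u - 2 *: LL X u.
Proof.
move=> su sX E.
pose f1 (u : TM) := - 2 * d (pullback sigma) G u.
pose f2 (u : TM) := 2 * energy L u.
have smoothZ (a : R) f : smooth_fun (tatlas A) slit f -> smooth_fun (tatlas A) slit (fun u => a * f u).
  move=> sf k c Ac; exact: (CkM (chart_image_open_dom rT Ac) (Ck_cst k _ (a : R^o)) (sf k c Ac)).
have dZ (a : R) f Y : smooth_fun (tatlas A) slit f -> d (fun u => a * f u) Y u = a * d f Y u.
  move=> sf; have df : derivable (local_fun f u) (chart_at (tatlas A) u u) (Y u).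
    by apply: diff_derivable; exact: (smooth_fun_diff sf (ra_at rT u) (ra_dom rT u) su).
  exact: (deriveZ a df).
have sf1 : smooth_fun (tatlas A) slit f1 := smoothZ _ _ s1.
have sf2 : smooth_fun (tatlas A) slit f2 := smoothZ _ _ sE.
have sC := smooth_liouville rM.
have sfC := slit_scale rM sf1 sC; have sfg := slit_scale rM sf2 sgrad.
have E' q : slit q -> Gt q = (G + (scale f1 liouville + scale f2 grad)) q.
  move=> sq; rewrite (E q sq) -addrA -scaleNr -mulNr; by [].
have e1 := fn_bracket_eq rM X su E'.
have e2 := fn_bracketD rM su sX sG (slitD rM sfC sfg).
have e3 := fn_bracketD rM su sX sfC sfg.
have e4 := fn_bracket_scale rM su sf1 sX sC vC.
have e5 := fn_bracket_scale rM su sf2 sX sgrad vgrad.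
have e6 := fn_bracket_liouville rM su sX.
have d1 : dJ f1 X u = - 2 * d (pullback sigma) X u.
  by rewrite -(d_J_spray_pullback rM ss su sG hG sX); exact: (dZ _ _ (J X) s1).
have d2 : dJ f2 X u = 2 * dJ (energy L) X u by exact: (dZ _ _ (J X) sE).
rewrite e6 d1 in e4; rewrite d2 in e5.
apply: (etrans (etrans (etrans e1 e2) (congr1 _ (etrans e3 (f_equal2 +%R e4 e5))))).
rewrite conformal_formE /f1 /f2 /barthel.
move: (B X u) (J X u) (liouville u) (grad u) (fn_bracket10 _ _ G X u) => b j c g k.
move: (d _ X u) (d _ G u) (dJ _ X u) (energy L u) => x y z e.
by apply/rowP => i; rewrite !mxE; ring.
Qed.

End ConformalForm.

Theorem theorem3p7 (R : realType) (n : nat) (M : topologicalType)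
    (A : atlas R M n) (hM : smooth_manifold A)
    (L Lt : tbundle A -> R) (hL : finsler L) (hLt : finsler Lt)
    (sigma : M -> R) (hsigma : smooth_fun A setT sigma)
    (hconf : conformal L Lt sigma)
    (G Gt : tbundle A -> 'rV[R]_(n + n))
    (hG : canonical_spray L G) (hGt : canonical_spray Lt Gt)
    (gb : tbundle A -> 'rV[R]_(n + n) -> 'rV[R]_(n + n) -> R)
    (hgb : vertical_metric L gb)
    (grad : tbundle A -> 'rV[R]_(n + n))
    (hgrad : vertical_gradient gb (pullback sigma) grad)
    (X Y : tbundle A -> 'rV[R]_(n + n))
    (hX : slit_field X) (hY : slit_field Y) :
  let h := hproj G in
  let v := vproj G in
  let LL := conformal_form L G (pullback sigma) grad in
  forall u, slit u ->
    curvature Gt X Y u =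
      (curvature G X Y - lie (LL X) (LL Y) - LL (lie (h X) (h Y))
       + alternate (fun X' Y' => v (lie (h X') (LL Y')) + LL (lie (h X') (LL Y')))
           X Y) u.
Proof.
move=> h v LL u su; have rM := regular_manifold hM.
have [sG _] := hG; have [sGt _] := hGt; have [sgrad vgrad _] := hgrad.
have spG := canonical_spray_spray hM hL hG.
have spGt := canonical_spray_spray hM hLt hGt.
have spray_change := conformal_spray hM hL hLt hsigma hconf hG hGt hgb hgrad.
have ah := slit_additive_hproj rM sG.
have aL := slit_additive_conformal_form hM hL hsigma sG sgrad.
have vL Z (sZ : slit_field Z) : vertical (LL Z).
  exact: (vertical_conformal_form hM L sigma G sgrad vgrad sZ).
have L0 V q (sq : slit q) (sV : slit_field V) (vV : vertical V) : LL V q = 0.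
  exact: (conformal_form_vertical hM L hsigma G sgrad vgrad sq sV vV).
have ht Z q : slit q -> slit_field Z -> hproj Gt Z q = h Z q - LL Z q.
  move=> sq sZ.
  have e := barthel_conformal hM hL hsigma sG spG sgrad vgrad sq sZ spray_change.
  have alg (a b c k : 'rV[R]_(n + n)) : b = c - 2 *: k ->
      2^-1 *: (a + b) = 2^-1 *: (a + c) - k.
    by move=> ->; apply/rowP => i; rewrite !mxE; field.
  exact: alg e.
have sh Z (sZ : slit_field Z) : slit_field (h Z) := sa_slit ah sZ.
have sL Z (sZ : slit_field Z) : slit_field (LL Z) := sa_slit aL sZ.
have [shX shY sLX sLY] : [/\ slit_field (h X), slit_field (h Y), slit_field (LL X) & slit_field (LL Y)].
  by split; [exact: sh|exact: sh|exact: sL|exact: sL].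
have sP := slit_lie rM shX shY; have sQ := slit_lie rM shX sLY.
have sS := slit_lie rM shY sLX; have sT := slit_lie rM sLX sLY.
have vT : vertical (lie (LL X) (LL Y)) := vertical_lie rM sLX sLY (vL X hX) (vL Y hY).
pose W := (lie (h X) (h Y) - lie (h X) (LL Y)) + (lie (h Y) (LL X) + lie (LL X) (LL Y)).
have sW : slit_field W := slitD rM (slitB rM sP sQ) (slitD rM sS sT).
have EW q : slit q -> lie (hproj Gt X) (hproj Gt Y) q = W q.
  move=> sq.
  have lieBr Z Y1 Y2 : slit_field Z -> slit_field Y1 -> slit_field Y2 ->
      lie Z (Y1 - Y2) q = lie Z Y1 q - lie Z Y2 q.
    move=> sZ sY1 sY2; apply/eqP; rewrite eq_sym subr_eq.
    by rewrite -(lieDr rM sq sZ (slitB rM sY1 sY2) sY2) subrK.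
  have e0 := lie_eq rM sq (Y := hproj Gt Y) (Y' := h Y - LL Y)
    (fun q sq => ht X q sq hX : hproj Gt X q = (h X - LL X) q) (fun q sq => ht Y q sq hY).
  apply: (etrans e0); apply: (etrans (lieBr _ _ _ (slitB rM shX sLX) shY sLY)).
  have e1 : lie (h X - LL X) (h Y) q = lie (h X) (h Y) q + lie (h Y) (LL X) q.
    apply: (etrans (lieC _ _ _)); apply: (etrans (congr1 -%R (lieBr _ _ _ shY shX sLX))).
    have alg (a b p : 'rV[R]_(n + n)) : p = - a -> - (a - b) = p + b.
      by move=> ->; rewrite opprB addrC.
    exact: alg (lieC _ _ _).
  have e2 : lie (h X - LL X) (LL Y) q = lie (h X) (LL Y) q - lie (LL X) (LL Y) q.
    apply: (etrans (lieC _ _ _)); apply: (etrans (congr1 -%R (lieBr _ _ _ sLY shX sLX))).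
    have alg (a b p t : 'rV[R]_(n + n)) : p = - a -> t = - b -> - (a - b) = p - t.
      by move=> -> ->; rewrite opprB opprK addrC.
    exact: alg (lieC _ _ _) (lieC _ _ _).
  have alg (p q' s t : 'rV[R]_(n + n)) : (p + s) - (q' - t) = (p - q') + (s + t).
    by rewrite opprB [t - q']addrC addrACA.
  exact: (etrans (f_equal2 (fun a b => a - b) e1 e2) (alg _ _ _ _)).
have KW K (aK : slit_additive K) : K W u = (K (lie (h X) (h Y)) u - K (lie (h X) (LL Y)) u)
    + (K (lie (h Y) (LL X)) u + K (lie (LL X) (LL Y)) u).
  apply: (etrans (sa_D aK (slitB rM sP sQ) (slitD rM sS sT) su)).
  by rewrite (sa_B rM aK sP sQ su) (sa_D aK sS sT su).
have aht := slit_additive_hproj rM sGt.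
have c1 := curvatureE rM sGt spGt su hX hY.
have c2 := curvatureE rM sG spG su hX hY.
have hW : hproj Gt (lie (hproj Gt X) (hproj Gt Y)) u = h W u - LL W u.
  by apply: (etrans (sa_eq aht EW su)); exact: ht.
have hWE := KW _ ah; have LWE := KW _ aL.
have T0 : h (lie (LL X) (LL Y)) u = 0 by exact: (hproj_vertical rM sG spG su sT vT).
have LT0 : LL (lie (LL X) (LL Y)) u = 0 by exact: L0.
have vE Z : v Z u = Z u - h Z u by exact: vprojE.
have alg (P Q S T hP hQ hS hT lP lQ lS lT c vQ vS z hw lw : 'rV[R]_(n + n)) :
  hw = hP - hQ + (hS + hT) -> lw = lP - lQ + (lS + lT) -> hT = 0 -> lT = 0 ->
  c = hP - P -> vQ = Q - hQ -> vS = S - hS -> z = hw - lw ->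
  z - (P - Q + (S + T)) = c - T - lP + ((vQ + lQ) - (vS + lS)).
  move=> -> -> -> -> -> -> -> ->; apply/rowP => i; rewrite !mxE; ring.
apply: (etrans c1); apply: (etrans (congr1 _ (congr1 -%R (EW u su)))).
exact: (alg _ _ _ _ _ _ _ _ _ _ _ _ _ _ _ _ _ _ hWE LWE T0 LT0 c2 (vE _) (vE _) hW).
Qed.
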